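(* If $G$ is a nonabelian group that is residually locally torsion-free nilpotent, and $\alpha$ is any nonidentity element of $\mathrm{Comm}(G)$, then there exists ${\prec} \in \mathrm{LO}(G)$ such that ${\prec}^\alpha \neq {\prec}$ (as elements of $\mathrm{VLO}(G)$).
   Context: A left-invariant order on a group $G$ is a (strict) total order $\prec$ on $G$ such that $x \prec y \Rightarrow gx \prec gy$ for all $x,y,g \in G$; $\mathrm{LO}(G)$ is the set of all of them. A commensuration of $G$ is an isomorphism $\phi \colon G_1 \to G_2$, where $G_1$ and $G_2$ are finite-index subgroups of $G$. Two commensurations $\phi \colon G_1 \to G_2$ and $\phi' \colon G_1' \to G_2'$ are equivalent if there is a finite-index subgroup $H$ of $G_1 \cap G_1'$ such that $\phi$ and $\phi'$ have the same restriction to $H$. The equivalence classes of commensurations form a group $\mathrm{Comm}(G)$ (the abstract commensurator), with multiplication given by composition restricted to a finite-index subgroup where it is defined. $\mathrm{VLO}(G)$ denotes the direct limit $\varinjlim \mathrm{LO}(H)$ over all finite-index subgroups $H$ of $G$, with respect to the restriction maps $\mathrm{LO}(H_2) \to \mathrm{LO}(H_1)$ for $H_1 \subseteq H_2$; thus an element is represented by a left-invariant order on some finite-index subgroup, and two such orders represent the same element iff they agree on some common finite-index subgroup. The natural map $\mathrm{LO}(G) \to \mathrm{VLO}(G)$ is injective, and $\mathrm{LO}(G)$ is regarded as a subset of $\mathrm{VLO}(G)$. $\mathrm{Comm}(G)$ acts on $\mathrm{VLO}(G)$: if $\alpha$ is represented by $\phi\colon G_1\to G_2$ and an element of $\mathrm{VLO}(G)$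 is represented by $\prec$ on $H$, then ${\prec}^\alpha$ is represented by the order on $\phi(H \cap G_1)$ defined by $\phi(x) \prec^\alpha \phi(y) \iff x \prec y$ for $x,y \in H\cap G_1$. (Elements of $\mathrm{Comm}(G)$ are written as acting on the right.) A group $G$ is residually locally torsion-free nilpotent if for every $g \neq e$ in $G$ there is a normal subgroup $N$ of $G$ with $g \notin N$ such that $G/N$ is torsion-free and locally nilpotent (every finitely generated subgroup of $G/N$ is nilpotent). *)

(* Defs.v *)
From HB Require Import structures.
From mathcomp Require Import all_boot.
From mathcomp Require Import boolp classical_sets functions cardinality.

Set Implicit Arguments.
Unset Strict Implicit.
Unset Printing Implicit Defensive.

Local Open Scope group_scope.
Local Open Scope quotient_scope.

(* A subgroup of [G] is a [groupClosed G]; [subg H] is [H] as a group.        *)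

Section Subg.
Variables (G : groupType) (H : groupClosed G).

Definition subg := {x : G | x \in H}.

HB.instance Definition _ := SubChoice.on subg.

Fact subg_closed : group_closed (fun x => x \in H).
Proof. by split; [exact: gpred1 | move=> x y xH yH; exact: gpredF]. Qed.

HB.instance Definition _ :=
  SubChoice_isSubGroup.Build G (fun x => x \in H) subg subg_closed.

End Subg.

Section Incl.
Variables (G : groupType) (H K : groupClosed G) (sHK : {subset H <= K}).

Definition subg_incl (x : subg H) : subg K := Sub (val x) (sHK (valP x)).

Fact subg_incl_mul : {morph subg_incl : x y / x * y}.
Proof. by move=> x y; apply: val_inj; rewrite !gmulfM. Qed.

HB.instance Definition _ :=
  isMultiplicative.Build (subg H) (subg K) subg_incl subg_incl_mul.

Fact subg_incl_inj : injective subg_incl.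
Proof. by move=> x y /(congr1 val) /= /val_inj. Qed.

End Incl.

Section GroupNotions.
Variable T : groupType.

Definition abelian_group := forall x y : T, commute x y.

Definition torsion_free := forall (x : T) n, (0 < n)%N -> x ^+ n = 1 -> x = 1.

Definition gen (A : {pred T}) : {pred T} :=
  [pred x | `[< forall H : groupClosed T, {subset A <= H} -> x \in H >]].

Fact gen_1 A : 1 \in gen A.
Proof. by apply/asboolP => H _; exact: gpred1. Qed.

Fact gen_M A : mulg_closed (gen A).
Proof.
move=> x y /asboolP xA /asboolP yA; apply/asboolP => H sAH.
by apply: gpredM; [exact: xA | exact: yA].
Qed.

Fact gen_V A : invg_closed (gen A).
Proof.
by move=> x /asboolP xA; apply/asboolP => H sAH; rewrite gpredV; exact: xA.
Qed.

HB.instance Definition _ A := isMulClosed.Build T (gen A) (@gen_M A).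
HB.instance Definition _ A := isMul1Closed.Build T (gen A) (gen_1 A).
HB.instance Definition _ A := isInvClosed.Build T (gen A) (@gen_V A).

Fixpoint lower_central (n : nat) : {pred T} :=
  if n is m.+1 then
    gen [pred g | `[< exists x y : T, x \in lower_central m /\ g = [~ x, y] >]]
  else predT.

Definition nilpotent := exists n, forall x, x \in lower_central n -> x = 1.

Definition finitely_generated (H : groupClosed T) :=
  exists s : seq T, H =i gen [in s].

End GroupNotions.

Definition locally_nilpotent (T : groupType) :=
  forall H : groupClosed T, finitely_generated H -> nilpotent (subg H).

Record normalSubgroup (G : groupType) := NormalSubgroup {
  normal_group :> groupClosed G;
  normal_conj : forall x g : G, x \in normal_group -> x ^ g \in normal_group
}.

Section Quotient.
Variables (G : groupType) (N : normalSubgroup G).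

Definition coset_eq : rel G := fun x y => x^-1 * y \in normal_group N.

Fact coset_eq_refl : reflexive coset_eq.
Proof. by move=> x; rewrite /coset_eq mulVg gpred1. Qed.

Fact coset_eq_sym : symmetric coset_eq.
Proof. by move=> x y; rewrite /coset_eq -gpredV invgM invgK. Qed.

Fact coset_eq_trans : transitive coset_eq.
Proof.
move=> y x z xy yz; rewrite /coset_eq.
have -> : x^-1 * z = (x^-1 * y) * (y^-1 * z) by rewrite !gnorm.
exact: gpredM.
Qed.

Canonical coset_equiv :=
  EquivRel coset_eq coset_eq_refl coset_eq_sym coset_eq_trans.

Definition quot := {eq_quot coset_equiv}.

HB.instance Definition _ := Choice.on quot.

Definition quot_pi (x : G) : quot := \pi_{eq_quot coset_equiv} x.

Definition quot_mul (a b : quot) : quot := quot_pi (repr a * repr b).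
Definition quot_inv (a : quot) : quot := quot_pi (repr a)^-1.

Fact quot_piP x y : reflect (quot_pi x = quot_pi y) (x^-1 * y \in normal_group N).
Proof. by apply: (iffP idP) => [xy|/eqmodP//]; apply/eqmodP. Qed.

Fact quot_ind (P : quot -> Prop) : (forall x, P (quot_pi x)) -> forall a, P a.
Proof. by move=> Px a; rewrite -[a]reprK; exact: Px. Qed.

Fact quot_mulE x y : quot_mul (quot_pi x) (quot_pi y) = quot_pi (x * y).
Proof.
rewrite /quot_mul; set x' := repr _; set y' := repr _.
have /quot_piP xN : quot_pi x' = quot_pi x by exact: reprK.
have /quot_piP yN : quot_pi y' = quot_pi y by exact: reprK.
apply/quot_piP.
have -> : (x' * y')^-1 * (x * y) = (y'^-1 * y) * (x'^-1 * x) ^ y.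
  by rewrite conjgE !gnorm.
by apply: gpredM => //; exact: normal_conj.
Qed.

Fact quot_invE x : quot_inv (quot_pi x) = quot_pi x^-1.
Proof.
rewrite /quot_inv; set x' := repr _.
have /quot_piP xN : quot_pi x = quot_pi x' by rewrite [RHS]reprK.
apply/quot_piP; have -> : x'^-1^-1 * x^-1 = (x^-1 * x') ^ x^-1.
  by rewrite conjgE !gnorm.
exact: normal_conj.
Qed.

Fact quot_mulA : associative quot_mul.
Proof.
by elim/quot_ind=> x; elim/quot_ind=> y; elim/quot_ind=> z; rewrite !quot_mulE mulgA.
Qed.
Fact quot_mul1 : left_id (quot_pi 1) quot_mul.
Proof. by elim/quot_ind=> x; rewrite quot_mulE mul1g. Qed.
Fact quot_mulr1 : right_id (quot_pi 1) quot_mul.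
Proof. by elim/quot_ind=> x; rewrite quot_mulE mulg1. Qed.
Fact quot_mulV : left_inverse (quot_pi 1) quot_inv quot_mul.
Proof. by elim/quot_ind=> x; rewrite quot_invE quot_mulE mulVg. Qed.
Fact quot_mulrV : right_inverse (quot_pi 1) quot_inv quot_mul.
Proof. by elim/quot_ind=> x; rewrite quot_invE quot_mulE mulgV. Qed.

HB.instance Definition _ := isGroup.Build quot
  quot_mulA quot_mul1 quot_mulr1 quot_mulV quot_mulrV.

End Quotient.

Definition residually_locally_torsion_free_nilpotent (G : groupType) :=
  forall g : G, g != 1 -> exists N : normalSubgroup G,
    [/\ g \notin normal_group N, torsion_free (quot N)
      & locally_nilpotent (quot N)].

Record LO (T : groupType) := LeftOrder {
  lo_lt :> rel T;
  lo_irr : irreflexive lo_lt;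
  lo_trans : transitive lo_lt;
  lo_total : forall x y, x != y -> lo_lt x y || lo_lt y x;
  lo_left : forall g x y, lo_lt x y -> lo_lt (g * x) (g * y)
}.

Fact LO_ext (T : groupType) (o o' : LO T) :
  (forall x y, o x y = o' x y) -> o = o'.
Proof.
case: o o' => [r i t c l] [r' i' t' c' l'] /= rr'.
have {}rr' : r = r' by apply/funext => x; apply/funext => y.
subst r'; congr LeftOrder; exact: Prop_irrelevance.
Qed.

Section Pullback.
Variables (T U : groupType) (f : {multiplicative T -> U}) (finj : injective f).
Variable o : LO U.

Definition pullback_lt : rel T := fun x y => o (f x) (f y).

Fact pullback_irr : irreflexive pullback_lt.
Proof. by move=> x; exact: lo_irr. Qed.
Fact pullback_trans : transitive pullback_lt.
Proof. by move=> y x z; exact: lo_trans. Qed.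
Fact pullback_total x y : x != y -> pullback_lt x y || pullback_lt y x.
Proof. by move=> xy; apply: lo_total; rewrite (inj_eq finj). Qed.
Fact pullback_left g x y : pullback_lt x y -> pullback_lt (g * x) (g * y).
Proof. by move=> xy; rewrite /pullback_lt !gmulfM lo_left. Qed.

Definition lo_pullback :=
  LeftOrder pullback_irr pullback_trans pullback_total pullback_left.

End Pullback.

Definition lo_res (G : groupType) (H K : groupClosed G)
    (sHK : {subset H <= K}) (o : LO (subg K)) : LO (subg H) :=
  lo_pullback (@subg_incl_inj _ _ _ sHK) o.

Definition finite_index (G : groupType) (H : groupClosed G) :=
  finite_set (range (fun x : G => [set y | x^-1 * y \in H]%classic)).

Record fiSubgroup (G : groupType) := FiSubgroup {
  fi_group :> groupClosed G;
  fi_index : finite_index fi_group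
}.

Section FiniteIndex.
Variable G : groupType.
Implicit Types H K : groupClosed G.

Fact finite_indexP H : finite_index H <->
  exists s : seq G, forall x, exists2 y, y \in s & y^-1 * x \in H.
Proof.
rewrite /finite_index; set f := fun x : G => _; split.
- case/finite_seqP => s Es; exists (map (xget 1) s) => x.
  have fxs : f x \in s by have : range f (f x) by []; rewrite Es.
  exists (xget 1 (f x)); first exact: map_f.
  have : f x (xget 1 (f x)) by apply: (@xgetPex _ 1 (f x)); exists x; rewrite /f/= mulVg gpred1.
  by rewrite /f /= -gpredV invgM invgK.
- case=> s sP; apply: (@sub_finite_set _ _ (f @` [set` s])%classic); last first.
    exact/finite_image/finite_seq.
  move=> _ [x _ <-]; have [y ys yx] := sP x; exists y => //.
  rewrite /f; apply/seteqP; split => z /= zH.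
    have -> : x^-1 * z = (y^-1 * x)^-1 * (y^-1 * z) by rewrite !gnorm.
    by apply: gpredM; rewrite ?gpredV.
  have -> : y^-1 * z = (y^-1 * x) * (x^-1 * z) by rewrite !gnorm.
  exact: gpredM.
Qed.

Definition fi_full_set : {pred G} := predT.
Fact full_1 : 1 \in fi_full_set. Proof. by []. Qed.
Fact full_M : mulg_closed fi_full_set. Proof. by []. Qed.
Fact full_V : invg_closed fi_full_set. Proof. by []. Qed.
HB.instance Definition _ := isMulClosed.Build G fi_full_set full_M.
HB.instance Definition _ := isMul1Closed.Build G fi_full_set full_1.
HB.instance Definition _ := isInvClosed.Build G fi_full_set full_V.

Fact full_index : finite_index fi_full_set.
Proof. by apply/finite_indexP; exists [:: 1] => x; exists 1; rewrite ?inE. Qed.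

Definition fi_full : fiSubgroup G := FiSubgroup full_index.

Section Cap.
Variables H K : groupClosed G.
Definition cap : {pred G} := [pred x | (x \in H) && (x \in K)].
Fact cap_1 : 1 \in cap. Proof. by rewrite inE !gpred1. Qed.
Fact cap_M : mulg_closed cap.
Proof. by move=> x y /andP[? ?] /andP[? ?]; rewrite inE !gpredM. Qed.
Fact cap_V : invg_closed cap.
Proof. by move=> x /andP[? ?]; rewrite inE !gpredV; apply/andP. Qed.
HB.instance Definition _ := isMulClosed.Build G cap cap_M.
HB.instance Definition _ := isMul1Closed.Build G cap cap_1.
HB.instance Definition _ := isInvClosed.Build G cap cap_V.

Fact cap_subl : {subset cap <= H}. Proof. by move=> x /andP[]. Qed.
Fact cap_subr : {subset cap <= K}. Proof. by move=> x /andP[]. Qed.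
End Cap.

Fact cap_index (H K : fiSubgroup G) : finite_index (cap H K).
Proof.
have /finite_indexP [s sP] := fi_index H; have /finite_indexP [t tP] := fi_index K.
pose S := [seq (y, z) | y <- s, z <- t].
pose P (p : G * G) := [set x : G | p.1^-1 * x \in H /\ p.2^-1 * x \in K]%classic.
apply/finite_indexP; exists [seq xget 1 (P p) | p <- S] => x.
have [y ys yx] := sP x; have [z zt zx] := tP x.
exists (xget 1 (P (y, z))); first exact/map_f/allpairs_f.
have [/= yw zw] : P (y, z) (xget 1 (P (y, z))) by apply: (@xgetPex _ 1 (P (y, z))); exists x.
move: (xget _ _) yw zw => w yw zw; rewrite inE.
have -> : w^-1 * x \in H.
  have -> : w^-1 * x = (y^-1 * w)^-1 * (y^-1 * x) by rewrite !gnorm.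
  by rewrite gpredM// gpredV.
have -> // : w^-1 * x = (z^-1 * w)^-1 * (z^-1 * x) by rewrite !gnorm.
by rewrite gpredM// gpredV.
Qed.

Definition fi_cap (H K : fiSubgroup G) : fiSubgroup G := FiSubgroup (cap_index H K).

End FiniteIndex.

Record commensuration (G : groupType) := Commensuration {
  comm_dom : fiSubgroup G;
  comm_cod : fiSubgroup G;
  comm_map :> {multiplicative subg comm_dom -> subg comm_cod};
  comm_bij : bijective comm_map
}.

HB.instance Definition _ G := gen_eqMixin (commensuration G).
HB.instance Definition _ G := gen_choiceMixin (commensuration G).

Section Extension.
Variables (G : groupType) (phi : commensuration G).

(* The extension of [phi] to [G] with value 1 outside its domain.             *)
Definition comm_ext (x : G) : G :=
  if insub x is Some u then val (comm_map phi u) else 1.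

Fact comm_extE (u : subg (comm_dom phi)) : comm_ext (val u) = val (phi u).
Proof. by rewrite /comm_ext valK. Qed.

Fact comm_extM : {in comm_dom phi &, {morph comm_ext : x y / x * y}}.
Proof.
move=> x y xD yD; have := comm_extE (Sub x xD * Sub y yD : subg _).
by rewrite !gmulfM /= => ->; rewrite -!comm_extE.
Qed.

Fact comm_ext_cod : {in comm_dom phi, forall x, comm_ext x \in comm_cod phi}.
Proof.
move=> x xD; have := comm_extE (Sub x xD : subg _) => /= ->; exact: valP.
Qed.

Fact comm_ext_inj : {in comm_dom phi &, injective comm_ext}.
Proof.
move=> x y xD yD.
have := comm_extE (Sub x xD : subg _) => /= ->.
have := comm_extE (Sub y yD : subg _) => /= -> /val_inj.
by move/(bij_inj (comm_bij phi))/(congr1 val).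
Qed.

Fact comm_ext_surj :
  {in comm_cod phi, forall y, exists2 x, x \in comm_dom phi & comm_ext x = y}.
Proof.
move=> y yC; have [g _ gK] := comm_bij phi.
pose u := g (Sub y yC); exists (val u); first exact: valP.
by rewrite comm_extE gK.
Qed.

Fact comm_ext1 : comm_ext 1 = 1.
Proof.
have D1 : 1 \in comm_dom phi by exact: gpred1.
by apply: (mulgI (comm_ext 1)); rewrite -comm_extM// !mulg1.
Qed.

Fact comm_extV : {in comm_dom phi, {morph comm_ext : x / x^-1}}.
Proof.
move=> x xD; apply: (mulgI (comm_ext x)).
by rewrite -comm_extM ?gpredV// !mulgV comm_ext1.
Qed.

End Extension.

Section CommOf.
Variables (G : groupType) (D C : fiSubgroup G) (f : G -> G).
Hypothesis fM : {in D &, {morph f : x y / x * y}}.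
Hypothesis fC : {in D, forall x, f x \in C}.
Hypothesis finj : {in D &, injective f}.
Hypothesis fsurj : {in C, forall y, exists2 x, x \in D & f x = y}.

Definition comm_of_fun (x : subg D) : subg C := Sub (f (val x)) (fC (valP x)).

Fact comm_of_mul : {morph comm_of_fun : x y / x * y}.
Proof.
by move=> x y; apply: val_inj; rewrite !gmulfM /= fM//; exact: valP.
Qed.

HB.instance Definition _ :=
  isMultiplicative.Build (subg D) (subg C) comm_of_fun comm_of_mul.

Fact comm_of_bij : bijective comm_of_fun.
Proof.
have inj : injective comm_of_fun.
  by move=> x y /(congr1 val) /= /finj xy; apply/val_inj/xy; exact: valP.
have surj y : exists x, comm_of_fun x = y.
  have [x xD xy] := fsurj (valP y); exists (Sub x xD); exact: val_inj.
pose g y := projT1 (cid (surj y)).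
have gK : cancel g comm_of_fun by move=> y; rewrite /g; case: cid.
by exists g => // x; apply: inj; rewrite gK.
Qed.

Definition comm_of : commensuration G := @Commensuration G D C comm_of_fun comm_of_bij.

Fact comm_of_ext : {in D, comm_ext comm_of =1 f}.
Proof.
by move=> x xD; have := @comm_extE _ comm_of (Sub x xD : subg _) => /= ->.
Qed.

End CommOf.

Section Image.
Variables (G : groupType) (phi : commensuration G).

(* The image of the intersection of [H] with the domain of [phi].             *)
Definition img (H : groupClosed G) : {pred G} :=
  [pred g | `[< exists2 x : subg (comm_dom phi), val x \in H & val (phi x) = g >]].

Fact imgP (H : groupClosed G) g :
  reflect (exists x, [/\ x \in comm_dom phi, x \in H & comm_ext phi x = g]) (g \in img H).
Proof.
apply: (iffP (asboolP _)) => [[x xH <-]|[x [xD xH <-]]].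
  by exists (val x); split=> //; [exact: valP | exact: comm_extE].
by exists (Sub x xD) => //; rewrite -comm_extE.
Qed.

Section Closed.
Variable H : groupClosed G.

Fact img_1 : 1 \in img H.
Proof. by apply/imgP; exists 1; rewrite !gpred1 comm_ext1. Qed.
Fact img_M : mulg_closed (img H).
Proof.
move=> _ _ /imgP[x [xD xH <-]] /imgP[y [yD yH <-]]; apply/imgP.
by exists (x * y); rewrite !gpredM// comm_extM.
Qed.
Fact img_V : invg_closed (img H).
Proof.
move=> _ /imgP[x [xD xH <-]]; apply/imgP.
by exists x^-1; rewrite !gpredV comm_extV.
Qed.
HB.instance Definition _ := isMulClosed.Build G (img H) img_M.
HB.instance Definition _ := isMul1Closed.Build G (img H) img_1.
HB.instance Definition _ := isInvClosed.Build G (img H) img_V.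
End Closed.

Fact img_index (H : fiSubgroup G) : finite_index (img H).
Proof.
have /finite_indexP [s sP] := fi_index (fi_cap H (comm_dom phi)).
have /finite_indexP [t tP] := fi_index (comm_cod phi).
apply/finite_indexP; exists [seq z * comm_ext phi y | z <- t, y <- s] => g.
have [z zt /comm_ext_surj[u uD zu]] := tP g.
have [y ys /andP[yuH yuD]] := sP u.
have yD : y \in comm_dom phi.
  have -> : y = u * (y^-1 * u)^-1 by rewrite !gnorm.
  by rewrite gpredM// gpredV.
exists (z * comm_ext phi y); first exact: allpairs_f.
apply/imgP; exists (y^-1 * u); split=> //.
by rewrite comm_extM ?gpredV// comm_extV// zu invgM mulgA.
Qed.

Definition fi_img (H : fiSubgroup G) : fiSubgroup G := FiSubgroup (img_index H).

End Image.

Section Comm.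
Variable G : groupType.
Implicit Types phi psi chi : commensuration G.

Definition comm_eq : rel (commensuration G) := fun phi psi =>
  `[< exists (H : fiSubgroup G) (s1 : {subset H <= comm_dom phi})
        (s2 : {subset H <= comm_dom psi}),
      forall x : subg H,
        val (phi (subg_incl s1 x)) = val (psi (subg_incl s2 x)) >].

Fact comm_eqP phi psi : reflect
  (exists H : fiSubgroup G, [/\ {subset H <= comm_dom phi},
     {subset H <= comm_dom psi} & {in H, comm_ext phi =1 comm_ext psi}])
  (comm_eq phi psi).
Proof.
apply: (iffP (asboolP _)) => [[H [s1 [s2 E]]]|[H [s1 s2 E]]]; exists H.
  split=> // x xH; have := E (Sub x xH); rewrite -!comm_extE.
  by [].
exists s1, s2 => x; rewrite -!comm_extE; apply: E; exact: (valP x).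
Qed.

Fact comm_eq_refl : reflexive comm_eq.
Proof. by move=> phi; apply/comm_eqP; exists (comm_dom phi); split. Qed.

Fact comm_eq_sym : symmetric comm_eq.
Proof.
by move=> phi psi; apply/comm_eqP/comm_eqP => -[H [s1 s2 E]]; exists H; split=> // x xH; rewrite E.
Qed.

Fact comm_eq_trans : transitive comm_eq.
Proof.
move=> psi phi chi /comm_eqP[H [s1 s2 E]] /comm_eqP[K [t1 t2 F]].
apply/comm_eqP; exists (fi_cap H K); split=> x /andP[xH xK]; [exact: s1|exact: t2|].
by rewrite E// F.
Qed.

Canonical comm_equiv :=
  EquivRel comm_eq comm_eq_refl comm_eq_sym comm_eq_trans.

Definition Comm := {eq_quot comm_equiv}.

HB.instance Definition _ := Choice.on Comm.

Definition comm_pi phi : Comm := \pi_{eq_quot comm_equiv} phi.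

Fact comm_piP phi psi : reflect (comm_pi phi = comm_pi psi) (comm_eq phi psi).
Proof. by apply: (iffP idP) => [?|/eqmodP//]; apply/eqmodP. Qed.

Fact comm_ind (P : Comm -> Prop) : (forall phi, P (comm_pi phi)) -> forall a, P a.
Proof. by move=> Px a; rewrite -[a]reprK; exact: Px. Qed.

Definition comm_id : commensuration G :=
  @Commensuration G (fi_full G) (fi_full G) idfun (Bijective (frefl _) (frefl _)).

Fact comm_id_ext x : comm_ext comm_id x = x.
Proof. by have := @comm_extE _ comm_id (Sub x isT : subg (fi_full G)) => /= ->. Qed.

Section Inverse.
Variable phi : commensuration G.

Definition inv_ext (y : G) : G :=
  xget 1 [set x | x \in comm_dom phi /\ comm_ext phi x = y]%classic.

Fact inv_extP y : y \in comm_cod phi ->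
  inv_ext y \in comm_dom phi /\ comm_ext phi (inv_ext y) = y.
Proof.
move=> /comm_ext_surj[x xD xy]; rewrite /inv_ext; set P := [set x | _]%classic.
by apply: (@xgetPex _ 1 P); exists x.
Qed.

Fact inv_extK : {in comm_dom phi, cancel (comm_ext phi) inv_ext}.
Proof.
move=> x xD; have [iD iE] := inv_extP (comm_ext_cod xD).
exact: (comm_ext_inj iD xD).
Qed.

Fact inv_ext_dom : {in comm_cod phi, forall y, inv_ext y \in comm_dom phi}.
Proof. by move=> y /inv_extP[]. Qed.
Fact inv_ext_mul : {in comm_cod phi &, {morph inv_ext : x y / x * y}}.
Proof.
move=> _ _ /comm_ext_surj[x xD <-] /comm_ext_surj[y yD <-].
by rewrite -comm_extM// !inv_extK// gpredM.
Qed.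
Fact inv_ext_inj : {in comm_cod phi &, injective inv_ext}.
Proof.
move=> _ _ /comm_ext_surj[x xD <-] /comm_ext_surj[y yD <-].
by rewrite !inv_extK// => ->.
Qed.
Fact inv_ext_surj :
  {in comm_dom phi, forall x, exists2 y, y \in comm_cod phi & inv_ext y = x}.
Proof.
by move=> x xD; exists (comm_ext phi x); [exact: comm_ext_cod | exact: inv_extK].
Qed.

Definition comm_inv : commensuration G :=
  comm_of inv_ext_mul inv_ext_dom inv_ext_inj inv_ext_surj.

Fact comm_inv_extK : {in comm_dom phi, cancel (comm_ext phi) (comm_ext comm_inv)}.
Proof. by move=> x xD; rewrite comm_of_ext ?inv_extK//; exact: comm_ext_cod. Qed.

End Inverse.

Section Composition.
Variables phi psi : commensuration G.

(* The composite "[phi], then [psi]", from phi^-1 (cod phi & dom psi) to      *)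
(* psi (cod phi & dom psi).                                                   *)
Let D := fi_img (comm_inv phi) (comm_dom psi).
Let C := fi_img psi (comm_cod phi).
Let f x := comm_ext psi (comm_ext phi x).

Fact comp_domP x :
  (x \in D) = (x \in comm_dom phi) && (comm_ext phi x \in comm_dom psi).
Proof.
apply/imgP/andP => [[y [/[dup] yC /comm_ext_surj[u uD <-] yD]]|[xD xE]].
  by rewrite comm_inv_extK// => <-.
exists (comm_ext phi x); split=> //; first exact: comm_ext_cod.
by rewrite comm_inv_extK.
Qed.

Fact comp_mul : {in D &, {morph f : x y / x * y}}.
Proof.
move=> x y; rewrite !comp_domP => /andP[? ?] /andP[? ?].
by rewrite /f !comm_extM.
Qed.
Fact comp_cod : {in D, forall x, f x \in C}.
Proof.
move=> x; rewrite comp_domP => /andP[xD xE]; apply/imgP.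
by exists (comm_ext phi x); split=> //; exact: comm_ext_cod.
Qed.
Fact comp_inj : {in D &, injective f}.
Proof.
move=> x y; rewrite !comp_domP => /andP[xD xE] /andP[yD yE] /comm_ext_inj.
by move=> /(_ xE yE) /comm_ext_inj; exact.
Qed.
Fact comp_surj : {in C, forall y, exists2 x, x \in D & f x = y}.
Proof.
move=> _ /imgP[y [yD /comm_ext_surj[x xD xy] <-]]; exists x; last by rewrite /f xy.
by rewrite comp_domP xD xy.
Qed.

Definition comm_comp : commensuration G :=
  comm_of comp_mul comp_cod comp_inj comp_surj.

Fact comm_comp_dom x : (x \in comm_dom comm_comp) =
  (x \in comm_dom phi) && (comm_ext phi x \in comm_dom psi).
Proof. exact: comp_domP. Qed.

Fact comm_comp_ext x : x \in comm_dom phi -> comm_ext phi x \in comm_dom psi ->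
  comm_ext comm_comp x = comm_ext psi (comm_ext phi x).
Proof. by move=> xD xE; rewrite comm_of_ext// comp_domP xD. Qed.

End Composition.

Fact comm_comp_eq phi phi' psi psi' : comm_eq phi phi' -> comm_eq psi psi' ->
  comm_eq (comm_comp phi psi) (comm_comp phi' psi').
Proof.
move=> /comm_eqP[H [s1 s2 E]] /comm_eqP[K [t1 t2 F]]; apply/comm_eqP.
exists (fi_cap H (fi_img (comm_inv phi) K)).
have L x : x \in fi_cap H (fi_img (comm_inv phi) K) -> x \in H /\ comm_ext phi x \in K.
  move=> /andP[xH /imgP[y [/comm_ext_surj[u uD <-] yK xE]]].
  by split=> //; rewrite -xE comm_inv_extK.
split=> x /L[xH xK].
- by rewrite comm_comp_dom s1// t1.
- by rewrite comm_comp_dom s2//= -E// t2.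
- have [xD xD'] := (s1 _ xH, s2 _ xH).
  have [yD yD'] := (t1 _ xK, t2 _ xK).
  by rewrite !comm_comp_ext -?E// F.
Qed.

Definition Comm_mul (a b : Comm) : Comm := comm_pi (comm_comp (repr a) (repr b)).
Definition Comm_inv (a : Comm) : Comm := comm_pi (comm_inv (repr a)).

Fact Comm_mulE phi psi :
  Comm_mul (comm_pi phi) (comm_pi psi) = comm_pi (comm_comp phi psi).
Proof. by apply/comm_piP/comm_comp_eq; apply/comm_piP; exact: reprK. Qed.

Fact Comm_mulA : associative Comm_mul.
Proof.
elim/comm_ind=> x; elim/comm_ind=> y; elim/comm_ind=> z; rewrite !Comm_mulE.
apply/comm_piP/comm_eqP; exists (comm_dom (comm_comp (comm_comp x y) z)).
have L u : u \in comm_dom (comm_comp (comm_comp x y) z) ->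
  [/\ u \in comm_dom x, comm_ext x u \in comm_dom y
    & comm_ext y (comm_ext x u) \in comm_dom z].
  rewrite comm_comp_dom => /andP[/[dup]]; rewrite {1}comm_comp_dom.
  by move=> /andP[ux uy] uxy; rewrite comm_comp_ext.
split=> // u /L[ux uy uz].
  by rewrite comm_comp_dom ux comm_comp_dom uy.
have uyz : comm_ext x u \in comm_dom (comm_comp y z).
  by rewrite comm_comp_dom uy.
have uxy : u \in comm_dom (comm_comp x y) by rewrite comm_comp_dom ux.
by rewrite !comm_comp_ext ?comm_comp_ext.
Qed.

Fact Comm_mul1 : left_id (comm_pi comm_id) Comm_mul.
Proof.
elim/comm_ind=> x; rewrite Comm_mulE; apply/comm_piP/comm_eqP.
exists (comm_dom x); split=> // u uD.
  by rewrite comm_comp_dom comm_id_ext.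
by rewrite comm_comp_ext ?comm_id_ext.
Qed.

Fact Comm_mulr1 : right_id (comm_pi comm_id) Comm_mul.
Proof.
elim/comm_ind=> x; rewrite Comm_mulE; apply/comm_piP/comm_eqP.
exists (comm_dom x); split=> // u uD.
  by rewrite comm_comp_dom uD.
by rewrite comm_comp_ext ?comm_id_ext.
Qed.

Fact Comm_mulrV : right_inverse (comm_pi comm_id) Comm_inv Comm_mul.
Proof.
move=> a; rewrite -{1}[a]reprK /Comm_inv [LHS]Comm_mulE; move: (repr a) => x.
apply/comm_piP/comm_eqP; exists (comm_dom x); split=> // u uD.
  by rewrite comm_comp_dom uD; exact: comm_ext_cod.
by rewrite comm_comp_ext ?comm_id_ext ?comm_inv_extK//; exact: comm_ext_cod.
Qed.

Fact Comm_mulV : left_inverse (comm_pi comm_id) Comm_inv Comm_mul.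
Proof.
move=> a; rewrite -{2}[a]reprK /Comm_inv [LHS]Comm_mulE; move: (repr a) => x.
apply/comm_piP/comm_eqP; exists (comm_cod x); split=> // u uC.
  rewrite comm_comp_dom uC; have /comm_ext_surj[v vD <-] := uC.
  by rewrite comm_inv_extK.
have /comm_ext_surj[v vD <-] := uC.
by rewrite comm_comp_ext ?comm_id_ext ?comm_inv_extK//; exact: comm_ext_cod.
Qed.

HB.instance Definition _ := isGroup.Build Comm
  Comm_mulA Comm_mul1 Comm_mulr1 Comm_mulV Comm_mulrV.

End Comm.

Record vorder (G : groupType) := VOrder {
  vo_dom : fiSubgroup G;
  vo_lo : LO (subg vo_dom)
}.

HB.instance Definition _ G := gen_eqMixin (vorder G).
HB.instance Definition _ G := gen_choiceMixin (vorder G).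

Section VLO.
Variable G : groupType.
Implicit Types p q r : vorder G.

Definition vo_eq : rel (vorder G) := fun p q =>
  `[< exists (H : fiSubgroup G) (s1 : {subset H <= vo_dom p})
        (s2 : {subset H <= vo_dom q}),
      lo_res s1 (vo_lo p) = lo_res s2 (vo_lo q) >].

Definition vo_ext p : rel G := fun x y =>
  if (insub x, insub y) is (Some u, Some v) then vo_lo p u v else false.

Fact vo_extE p (u v : subg (vo_dom p)) : vo_ext p (val u) (val v) = vo_lo p u v.
Proof. by rewrite /vo_ext !valK. Qed.

Fact vo_eqP p q : reflect
  (exists H : fiSubgroup G, [/\ {subset H <= vo_dom p}, {subset H <= vo_dom q}
     & {in H &, forall x y, vo_ext p x y = vo_ext q x y}])
  (vo_eq p q).
Proof.
apply: (iffP (asboolP _)) => [[H [s1 [s2 E]]]|[H [s1 s2 E]]]; exists H.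
  split=> // x y xH yH.
  have := congr1 (fun o : LO (subg H) => o (Sub x xH) (Sub y yH)) E.
  by rewrite /= /pullback_lt -!vo_extE.
exists s1, s2; apply: LO_ext => x y; rewrite /= /pullback_lt -!vo_extE.
by apply: E; [exact: (valP x) | exact: (valP y)].
Qed.

Fact vo_eq_refl : reflexive vo_eq.
Proof. by move=> p; apply/vo_eqP; exists (vo_dom p); split. Qed.

Fact vo_eq_sym : symmetric vo_eq.
Proof.
by move=> p q; apply/vo_eqP/vo_eqP => -[H [s1 s2 E]]; exists H; split=> // x y xH yH; rewrite E.
Qed.

Fact vo_eq_trans : transitive vo_eq.
Proof.
move=> q p r /vo_eqP[H [s1 s2 E]] /vo_eqP[K [t1 t2 F]].
apply/vo_eqP; exists (fi_cap H K); split.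
- by move=> x /andP[xH _]; exact: s1.
- by move=> x /andP[_ xK]; exact: t2.
- by move=> x y /andP[xH xK] /andP[yH yK]; rewrite E// F.
Qed.

Canonical vo_equiv := EquivRel vo_eq vo_eq_refl vo_eq_sym vo_eq_trans.

Definition VLO := {eq_quot vo_equiv}.

HB.instance Definition _ := Choice.on VLO.

Definition vlo_pi p : VLO := \pi_{eq_quot vo_equiv} p.

Fact vlo_piP p q : reflect (vlo_pi p = vlo_pi q) (vo_eq p q).
Proof. by apply: (iffP idP) => [?|/eqmodP//]; apply/eqmodP. Qed.

Definition vlo_of (o : LO G) : VLO :=
  vlo_pi (@VOrder G (fi_full G)
    (lo_pullback (f := (val : {multiplicative subg (fi_full G) -> G})) val_inj o)).

Section Action.
Variables (p : vorder G) (phi : commensuration G).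

Let H := fi_cap (vo_dom p) (comm_dom phi).
Let inO : subg H -> subg (vo_dom p) := subg_incl (@cap_subl _ _ _).
Let inD : subg H -> subg (comm_dom phi) := subg_incl (@cap_subr _ _ _).

Definition act_lt : rel (subg (fi_img phi (vo_dom p))) := fun a b =>
  `[< exists x y : subg H, [/\ val (phi (inD x)) = val a,
        val (phi (inD y)) = val b & vo_lo p (inO x) (inO y)] >].

Fact act_ltE (x y : subg H) a b :
  val (phi (inD x)) = val a -> val (phi (inD y)) = val b ->
  act_lt a b = vo_lo p (inO x) (inO y).
Proof.
move=> xa yb; apply/asboolP/idP => [[x' [y' [x'a y'b]]]|xy]; last by exists x, y.
have I u v : val (phi (inD u)) = val (phi (inD v)) -> u = v.
  by move=> /val_inj /(bij_inj (comm_bij phi)) /subg_incl_inj.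
by rewrite (I x x') ?xa// (I y y') ?yb.
Qed.

Fact act_surj (a : subg (fi_img phi (vo_dom p))) :
  exists x : subg H, val (phi (inD x)) = val a.
Proof.
have /imgP[x [xD xO xa]] := valP a.
have xH : x \in H by rewrite inE xO.
by exists (Sub x xH); rewrite -comm_extE.
Qed.

Fact act_irr : irreflexive act_lt.
Proof.
by move=> a; have [x xa] := act_surj a; rewrite (act_ltE xa xa) lo_irr.
Qed.
Fact act_trans : transitive act_lt.
Proof.
move=> b a c; have [x xa] := act_surj a; have [y yb] := act_surj b.
have [z zc] := act_surj c.
rewrite (act_ltE xa yb) (act_ltE yb zc) (act_ltE xa zc); exact: lo_trans.
Qed.
Fact act_total a b : a != b -> act_lt a b || act_lt b a.
Proof.
have [x xa] := act_surj a; have [y yb] := act_surj b.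
rewrite (act_ltE xa yb) (act_ltE yb xa) => ab; apply: lo_total.
apply: contraNneq ab => /subg_incl_inj xy.
by apply/eqP/val_inj; rewrite -xa -yb xy.
Qed.
Fact act_left g a b : act_lt a b -> act_lt (g * a) (g * b).
Proof.
have [x xa] := act_surj a; have [y yb] := act_surj b; have [z zg] := act_surj g.
rewrite (act_ltE xa yb).
have E u c : val (phi (inD u)) = val c -> val (phi (inD (z * u))) = val (g * c).
  move=> uc; have -> : inD (z * u) = inD z * inD u by exact: gmulfM.
  by rewrite !gmulfM; congr (_ * _).
rewrite (act_ltE (E _ _ xa) (E _ _ yb)).
have F u v : inO (u * v) = inO u * inO v by exact: gmulfM.
rewrite !F; exact: lo_left.
Qed.

Definition vo_act : vorder G :=
  @VOrder G (fi_img phi (vo_dom p)) (LeftOrder act_irr act_trans act_total act_left).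

Fact vo_act_ext x y : x \in vo_dom p -> x \in comm_dom phi ->
    y \in vo_dom p -> y \in comm_dom phi ->
  vo_ext vo_act (comm_ext phi x) (comm_ext phi y) = vo_ext p x y.
Proof.
move=> xO xD yO yD.
have I z : z \in vo_dom p -> z \in comm_dom phi -> comm_ext phi z \in vo_dom vo_act.
  by move=> zO zD; apply/imgP; exists z.
have xH : x \in H by rewrite inE xO.
have yH : y \in H by rewrite inE yO.
have -> := @vo_extE vo_act (Sub (comm_ext phi x) (I x xO xD))
  (Sub (comm_ext phi y) (I y yO yD)).
rewrite [LHS](@act_ltE (Sub x xH) (Sub y yH)) -?comm_extE//.
by rewrite -vo_extE.
Qed.

End Action.

Fact vo_act_eq p q phi psi : vo_eq p q -> comm_eq phi psi ->
  vo_eq (vo_act p phi) (vo_act q psi).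
Proof.
move=> /vo_eqP[H [s1 s2 E]] /comm_eqP[K [t1 t2 F]]; apply/vo_eqP.
exists (fi_img phi (fi_cap H K)).
have L a : a \in fi_img phi (fi_cap H K) ->
    exists x, [/\ x \in H, x \in K & comm_ext phi x = a].
  by move=> /imgP[x [_ /andP[xH xK] xa]]; exists x.
split.
- move=> _ /L[x [xH xK <-]]; apply/imgP; exists x; split=> //; [exact: t1|exact: s1].
- move=> _ /L[x [xH xK <-]]; apply/imgP.
  by exists x; split=> //; [exact: t2|exact: s2|rewrite F].
- move=> _ _ /L[x [xH xK <-]] /L[y [yH yK <-]].
  by rewrite vo_act_ext ?s1 ?t1// !F// vo_act_ext ?s2 ?t2// E.
Qed.

Definition vlo_act (v : VLO) (a : Comm G) : VLO := vlo_pi (vo_act (repr v) (repr a)).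

Fact vlo_actE p phi : vlo_act (vlo_pi p) (comm_pi phi) = vlo_pi (vo_act p phi).
Proof.
by apply/vlo_piP/vo_act_eq; [apply/vlo_piP | apply/comm_piP]; exact: reprK.
Qed.

Fact vlo_ind (P : VLO -> Prop) : (forall p, P (vlo_pi p)) -> forall v, P v.
Proof. by move=> Pp v; rewrite -[v]reprK; exact: Pp. Qed.

Fact vlo_act1 v : vlo_act v 1 = v.
Proof.
elim/vlo_ind: v => p; rewrite [LHS](vlo_actE p (comm_id G)).
apply/vlo_piP/vo_eqP; exists (vo_dom p); split=> // [x xp|x y xp yp].
  by apply/imgP; exists x; rewrite comm_id_ext.
by rewrite -[x in LHS]comm_id_ext -[y in LHS]comm_id_ext vo_act_ext.
Qed.

Fact vlo_actM v (a b : Comm G) : vlo_act v (a * b) = vlo_act (vlo_act v a) b.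
Proof.
elim/vlo_ind: v => p; elim/comm_ind: a => phi; elim/comm_ind: b => psi.
rewrite [comm_pi phi * _]Comm_mulE !vlo_actE; apply/vlo_piP/vo_eqP.
set D := vo_dom (vo_act p (comm_comp phi psi)); exists D.
have L z : z \in D -> exists x, [/\ x \in vo_dom p, x \in comm_dom phi,
    comm_ext phi x \in comm_dom psi & comm_ext psi (comm_ext phi x) = z].
  move=> /imgP[x [/[dup] xD]]; rewrite comm_comp_dom => /andP[xphi xpsi] xp <-.
  by exists x; rewrite comm_comp_ext.
have I x : x \in vo_dom p -> x \in comm_dom phi ->
    comm_ext phi x \in vo_dom (vo_act p phi).
  by move=> xp xphi; apply/imgP; exists x.
split=> // [_ /L[x [xp xphi xpsi <-]]|].
  by apply/imgP; exists (comm_ext phi x); split=> //; exact: I.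
move=> _ _ /L[x [xp xphi xpsi <-]] /L[y [yp yphi ypsi <-]].
rewrite vo_act_ext ?I// vo_act_ext// -!comm_comp_ext//.
by rewrite vo_act_ext ?comm_comp_dom ?xphi ?yphi.
Qed.

End VLO.

(* Main.v *)
Require Import Defs.
From HB Require Import structures.
From mathcomp Require Import all_boot.
From mathcomp Require Import boolp classical_sets.

Set Implicit Arguments.
Unset Strict Implicit.
Unset Printing Implicit Defensive.

Local Open Scope group_scope.

(** The proof is by contradiction.  Let [phi : G1 -> G2] represent [alpha], and
    suppose that [alpha] fixes every left-invariant order of [G].  For an order
    [o], the orders [o] and [o^alpha] agree on some finite-index subgroup, and
    an element has the sign of its powers, so [x] and [phi x] have the same
    [o]-sign for every [x] in [G1] ([fixed_order_sign]).

    The group has enough left orders to make this very restrictive.  If [x] and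
    [y] are nontrivial and no positive powers of them coincide, then some left
    order has [x > 1 > y] ([exists_separating_order]).  By compactness
    ([extendable_order]) it suffices to choose signs for finitely many
    nontrivial elements [F] so that no product of the chosen elements is
    trivial.  This goes by induction on [F], as in the Burns-Hale theorem: a
    submonoid [P] that contains [g] or [g^-1] for each [g] in [F] decides the
    sign of the elements of [F] outside the subgroup of units of [P], and leaves
    the others, which are fewer, to the induction.  Such a [P] comes from the
    abelianization of the subgroup generated by [F], or of its image in a
    nilpotent torsion-free quotient of [G].  In an abelian group one finds a
    proper [P] containing [x] and [y^-1], unless the group is, up to powers,
    generated by [x] ([abelian_cone_or_rank_one]).  A nonabelian torsion-free
    nilpotent group never has so small an abelianization
    ([abelian_of_rank_one]), and in an abelian group the exceptional case makes
    positive powers of [x] and [y] coincide.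

    Consequently each [x] in [G1] satisfies [x ^+ p = phi x ^+ q] for some
    positive [p] and [q].  Look at this relation in a torsion-free locally
    nilpotent quotient of [G].  The ratio of [p] to [q] is the same for two
    commuting elements ([ratio_commute]), hence for any two elements, by
    comparing both with a central element of the nilpotent subgroup that they
    generate ([ratio_constant]).  If the quotient is nonabelian, it contains
    [u] and [v] whose commutator is nontrivial and commutes with both; raising
    [u] and [v] to a power [r] raises that commutator to the power [r * r], so
    the ratio is 1 ([ratio_one]).  Since roots are unique, [phi] is trivial
    modulo the kernel.  One nonabelian quotient therefore fixes the ratio at 1
    in all the others, and [phi] is the identity of [G1]
    ([comm_ext_fixed]). *)

(** * Subgroups given by generators *)

Section GeneratedSubgroups.
Variable T : groupType.
Implicit Types (A : {pred T}) (x y : T).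

Section OfProp.
Variable P : T -> Prop.
Hypotheses (P1 : P 1) (PM : forall x y, P x -> P y -> P (x * y))
  (PV : forall x, P x -> P x^-1).

(** A [Prop]-valued subgroup as a collective predicate, to which the universal
    property of [gen] applies. *)
Definition prop_pred : {pred T} := [pred x | `[< P x >]].

Fact prop_pred1 : 1 \in prop_pred. Proof. exact/asboolP. Qed.
Fact prop_predM : mulg_closed prop_pred.
Proof. by move=> x y /asboolP Px /asboolP Py; apply/asboolP; exact: PM. Qed.
Fact prop_predV : invg_closed prop_pred.
Proof. by move=> x /asboolP Px; apply/asboolP; exact: PV. Qed.

HB.instance Definition _ := isMulClosed.Build T prop_pred prop_predM.
HB.instance Definition _ := isMul1Closed.Build T prop_pred prop_pred1.
HB.instance Definition _ := isInvClosed.Build T prop_pred prop_predV.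

Lemma gen_ind A : (forall x, x \in A -> P x) -> forall x, x \in gen A -> P x.
Proof.
move=> AP x /asboolP /(_ (GroupClosed.clone _ prop_pred _)) xP.
by apply/asboolP/xP => y yA; apply/asboolP/AP.
Qed.

End OfProp.

Lemma sub_gen A : {subset A <= gen A}.
Proof. by move=> x xA; apply/asboolP => H; apply. Qed.

End GeneratedSubgroups.

(** * The upper central series and roots *)
Section Hypercentral.
Variable T : groupType.

(** Membership in the [n]-th term of the upper central series. *)
Fixpoint hypercentral (n : nat) (g : T) : Prop :=
  if n is m.+1 then forall h, hypercentral m [~ g, h] else g = 1.

(** If the lower central series reaches 1 after [n] steps, then its
    [(n - i)]-th term lies in the [i]-th term of the upper one; take [i = n]. *)
Lemma nilpotent_hypercentral :
  nilpotent T -> exists n, forall g, hypercentral n g.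
Proof.
case=> n nP; exists n => g.
suff H i m (x : T) : (i + m)%N = n -> x \in lower_central m -> hypercentral i x.
  by apply: (H n 0%N); rewrite ?addn0.
elim: i m x => [|i IH] m x; first by rewrite add0n => -> /nP.
rewrite addSnnS => inm xm h; apply: (IH _ _ inm); apply: sub_gen.
by apply/asboolP; exists x, h.
Qed.

(** The upper central series stops for good once it repeats a term; this yields
    new elements at each level of a nilpotent group that is not exhausted. *)
Lemma hypercentral_stable k n g :
  (forall u, hypercentral k.+1 u -> hypercentral k u) ->
  hypercentral (n + k) g -> hypercentral k g.
Proof.
move=> kS; elim: n g => [//|n IH] g gn; apply: kS => h.
by apply: IH; exact: gn.
Qed.

Lemma hypercentral1 g : hypercentral 1 g <-> forall h, commute g h.
Proof. by split=> gc h; [apply/commgP/eqP; exact: gc | apply/eqP/commgP; exact: gc]. Qed.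

Hypothesis tfT : torsion_free T.

(** Put [w = [~ u, v]], one level below [u] in the upper central series, so that
    [v^-1 ^ u = w * v^-1].  Since [u] commutes with [v ^+ k], both [v^-1] and its
    conjugate have the same [k]-th power, which therefore commutes with [w]; by
    induction [w] commutes with [v], so [w ^+ k = 1]. *)
Lemma commute_root n k u v : (0 < k)%N -> hypercentral n u ->
  commute u (v ^+ k) -> commute u v.
Proof.
move=> k0; elim: n u => [u -> _|n IH u un uvk].
  exact/commute_sym/commute1.
set w := [~ u, v]; set V := v^-1.
have uV : commute u (V ^+ k) by rewrite expVgn; exact: commuteV.
have Vu : V ^ u = w * V by rewrite conjgE /w commgEl conjgE /V !gnorm.
have VuX : (V ^ u) ^+ k = V ^+ k.
  by rewrite -conjXg; apply/conjg_fixP/commgP/commute_sym.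
have wVk : commute w (V ^+ k).
  have -> : w = V ^ u * v by rewrite Vu /V mulgVK.
  apply: commute_sym; apply: commuteM.
    by rewrite -VuX; apply/commute_sym/commuteX.
  by apply: commute_sym; apply: commuteX; exact: commuteV.
have /(_ wVk) wV : commute w (V ^+ k) -> commute w V.
  rewrite /V expVgn => /commuteV; rewrite invgK => wvk.
  by apply/commuteV/IH => //; exact: un.
apply/commgP/eqP/(tfT k0).
rewrite -/w; apply: (@mulIg _ (V ^+ k)).
by rewrite mul1g -[RHS]VuX Vu (expgMn _ wV).
Qed.

End Hypercentral.

(** * Abelianization and central quotient *)
Section Quotients.
Variable T : groupType.

Fact quot_pi_mul (N : normalSubgroup T) : {morph quot_pi N : x y / x * y}.
Proof. by move=> x y; exact/esym/quot_mulE. Qed.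

HB.instance Definition _ (N : normalSubgroup T) :=
  isUMagmaMorphism.Build T (quot N) (quot_pi N) (erefl 1, @quot_pi_mul N).

Lemma quot_pi1P (N : normalSubgroup T) x :
  quot_pi N x = 1 <-> x \in normal_group N.
Proof.
split=> [x1|xN].
  have /quot_piP : quot_pi N 1 = quot_pi N x by rewrite x1.
  by rewrite invg1 mul1g.
by symmetry; apply/quot_piP; rewrite invg1 mul1g.
Qed.

Definition commutators : {pred T} :=
  [pred g | `[< exists x y : T, g = [~ x, y] >]].

Lemma mem_commutator x y : [~ x, y] \in gen commutators.
Proof. by apply: sub_gen; apply/asboolP; exists x, y. Qed.

Fact derived_conj (x g : T) : x \in gen commutators -> x ^ g \in gen commutators.
Proof.
move=> xD; have -> : x ^ g = x * [~ x, g] by rewrite commgEl mulVKg.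
by apply: gpredM => //; exact: mem_commutator.
Qed.

Definition derived : normalSubgroup T := NormalSubgroup derived_conj.

Lemma quot_derived_abelian : abelian_group (quot derived).
Proof.
elim/quot_ind=> x; elim/quot_ind=> y.
apply/commgP/eqP; rewrite -gmulfR; apply/quot_pi1P; exact: mem_commutator.
Qed.

Definition center : {pred T} := [pred g | `[< forall h : T, commute g h >]].

Fact center1 : 1 \in center.
Proof. by apply/asboolP => h; exact/commute_sym/commute1. Qed.
Fact centerM : mulg_closed center.
Proof.
move=> x y /asboolP xZ /asboolP yZ; apply/asboolP => h.
by apply/commute_sym/commuteM; apply/commute_sym.
Qed.
Fact centerV : invg_closed center.
Proof.
by move=> x /asboolP xZ; apply/asboolP => h; apply/commute_sym/commuteV/commute_sym.
Qed.
HB.instance Definition _ := isMulClosed.Build T center centerM.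
HB.instance Definition _ := isMul1Closed.Build T center center1.
HB.instance Definition _ := isInvClosed.Build T center centerV.

Fact center_conj (x g : T) : x \in center -> x ^ g \in center.
Proof.
by move=> xZ; have /asboolP xc := xZ; rewrite conjgE xc mulKg.
Qed.

Definition normal_center : normalSubgroup T := NormalSubgroup center_conj.

End Quotients.

Arguments commutators T : clear implicits.
Arguments center T : clear implicits.

Lemma derived_morph (T U : groupType) (f : UMagmaMorphism.type T U) x :
  x \in gen (commutators T) -> f x \in gen (commutators U).
Proof.
apply: (@gen_ind _ (fun x => f x \in gen (commutators U))).
- by rewrite gmulf1 gpred1.
- by move=> a b fa fb; rewrite gmulfM gpredM.
- by move=> a fa; rewrite gmulfV gpredV.
- by move=> _ /asboolP[a [b ->]]; rewrite gmulfR mem_commutator.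
Qed.

(** A torsion-free nilpotent group is abelian as soon as its abelianization is,
    up to powers, generated by one element [x].  The quotient by the center is
    again torsion-free, because roots preserve commutation, so by induction on
    the class it is abelian.  Then commutators are central, each [h] has a power
    that is a power of [x] times a central element, and taking roots shows first
    that [x] is central and then that every [h] is. *)
Lemma abelian_of_rank_one n (T : groupType) (x : T) : torsion_free T ->
  (forall g : T, hypercentral n g) ->
  (forall h, exists k a b, (0 < k)%N /\
     (x ^+ a)^-1 * (h ^+ k * x ^+ b) \in gen (commutators T)) ->
  abelian_group T.
Proof.
elim: n T x => [|n IH] T x tfT nT hx.
  by move=> u v; rewrite (nT u) (nT v).
have root (k : nat) (u v : T) : (0 < k)%N -> commute u (v ^+ k) -> commute u v.
  by move=> k0; exact: (commute_root tfT k0 (nT u)).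
pose Z := normal_center T.
have abZ : abelian_group (quot Z).
  apply: (IH _ (quot_pi Z x)).
  - elim/quot_ind=> g k k0 gk; apply/quot_pi1P/asboolP => h.
    have /quot_pi1P/asboolP gkZ : quot_pi Z (g ^+ k) = 1 by rewrite gmulfXn.
    exact/commute_sym/(root k)/commute_sym.
  - suff H m g : hypercentral m.+1 g -> hypercentral m (quot_pi Z g).
      by elim/quot_ind=> g; apply: H.
    elim: m g => [|m IHm] g gm.
      by apply/quot_pi1P/asboolP/hypercentral1.
    by elim/quot_ind=> h; rewrite -gmulfR; apply: IHm; exact: gm.
  - elim/quot_ind=> h; have [k [a [b [k0 hD]]]] := hx h.
    exists k, a, b; split=> //.
    by have := derived_morph (quot_pi Z) hD; rewrite !gmulfM gmulfV !gmulfXn.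
have DZ g : g \in gen (commutators T) -> forall h, commute g h.
  move=> gD; apply/asboolP; move: g gD.
  apply: (@gen_ind _ (fun g => g \in center T)).
  - exact: gpred1.
  - by move=> u v; exact: gpredM.
  - by move=> u; rewrite gpredV.
  - move=> _ /asboolP[u [v ->]]; apply/(quot_pi1P Z); rewrite gmulfR.
    by apply/eqP/commgP; exact: abZ.
have hk h : exists k a b z, [/\ (0 < k)%N, forall g, commute z g
    & h ^+ k = x ^+ a * z * (x ^+ b)^-1].
  have [k [a [b [k0 /DZ hz]]]] := hx h.
  by exists k, a, b, ((x ^+ a)^-1 * (h ^+ k * x ^+ b)); split; rewrite // mulVKg mulgK.
have xc h : commute x h.
  have [k [a [b [z [k0 zc hz]]]]] := hk h.
  apply: (root k) => //; rewrite hz; apply: commuteM; last first.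
    exact/commuteV/commuteX.
  apply: commuteM; first exact: commuteX.
  exact: commute_sym.
move=> g h; have [k [a [b [z [k0 zc hz]]]]] := hk h.
apply: (root k) => //; rewrite hz.
apply: commuteM; last exact/commuteV/commuteX/commute_sym.
by apply: commuteM; [exact/commuteX/commute_sym|exact: commute_sym].
Qed.

(** * Submonoids deciding signs *)
Section Cones.
Variable T : groupType.
Implicit Types (P : T -> Prop) (x y g h : T) (F : seq T).

Definition submonoid P := P 1 /\ forall x y, P x -> P y -> P (x * y).

Lemma submonoidX P x n : submonoid P -> P x -> P (x ^+ n).
Proof.
by case=> P1 PM Px; elim: n => [|n IH]; rewrite ?expg0 // expgS; exact: PM.
Qed.

Definition cone P x y F :=
  [/\ submonoid P, P x, P y^-1 & forall g, g \in F -> P g \/ P g^-1].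

Section Abelian.
Hypothesis abT : abelian_group T.

Lemma submonoid_mul P Q : submonoid P -> submonoid Q ->
  submonoid (fun t => exists p q, [/\ P p, Q q & t = p * q]).
Proof.
move=> [P1 PM] [Q1 QM]; split; first by exists 1, 1; rewrite mulg1.
move=> _ _ [p [q [Pp Qq ->]]] [p' [q' [Pp' Qq' ->]]].
exists (p * p'), (q * q'); split; [exact: PM|exact: QM|].
by rewrite !mulgA; congr (_ * _); rewrite -!mulgA; congr (_ * _); exact: abT.
Qed.

Lemma submonoid_powers g : submonoid (fun t => exists n, t = g ^+ n).
Proof.
split; first by exists 0%N.
by move=> _ _ [m ->] [n ->]; exists (m + n)%N; rewrite expgnDr.
Qed.

(** If a power of [h] fell in the monoid generated by [P] and [g], and another
    one in the monoid generated by [P] and [g^-1], then a suitable product of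
    powers of these two powers would lose its factors [g] and lie in [P]. *)
Lemma submonoid_extend P h g : submonoid P ->
  (forall k, (0 < k)%N -> ~ P (h ^+ k)) ->
  exists P', [/\ submonoid P', forall p, P p -> P' p,
    forall k, (0 < k)%N -> ~ P' (h ^+ k) & P' g \/ P' g^-1].
Proof.
move=> mP Ph.
pose adj u t := exists p q, [/\ P p, exists n, q = u ^+ n & t = p * q].
have [P1 PM] := mP.
have adjP u : [/\ submonoid (adj u), forall p, P p -> adj u p & adj u u].
  split; first exact/submonoid_mul/submonoid_powers.
    by move=> p Pp; exists p, 1; split; rewrite ?mulg1 //; exists 0%N.
  by exists 1, u; split; rewrite ?mul1g //; exists 1%N.
have [[k [k0 [p [_ [Pp [n ->] hk]]]]]|gh] :=
  EM (exists k, (0 < k)%N /\ adj g (h ^+ k)); last first.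
  have [? ? ?] := adjP g; exists (adj g); split=> //; last by left.
  by move=> k k0 gk; apply: gh; exists k.
have [[l [l0 [q [_ [Pq [m ->] hl]]]]]|gh] :=
  EM (exists k, (0 < k)%N /\ adj g^-1 (h ^+ k)); last first.
  have [? ? ?] := adjP g^-1; exists (adj g^-1); split=> //; last by right.
  by move=> j j0 gj; apply: gh; exists j.
have m0 : (0 < m)%N.
  by case: m hl => // hl; case: (Ph l l0); rewrite hl mulg1.
(* The exponents m and n make the powers of g and g^-1 cancel. *)
case: (Ph (k * m + l * n)%N); first by rewrite addn_gt0 muln_gt0 k0 m0.
suff -> : h ^+ (k * m + l * n) = p ^+ m * q ^+ n.
  by apply: PM; exact: submonoidX.
rewrite expgnDr !expgnA hk hl !expgMn; try exact: abT.
rewrite -!expgnA expVgn [(m * n)%N]mulnC.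
rewrite [q ^+ n * _]abT -!mulgA; congr (_ * _).
by rewrite mulVKg.
Qed.

Lemma submonoid_extends P h F : submonoid P ->
  (forall k, (0 < k)%N -> ~ P (h ^+ k)) ->
  exists P', [/\ submonoid P', forall p, P p -> P' p,
    forall k, (0 < k)%N -> ~ P' (h ^+ k)
    & forall g, g \in F -> P' g \/ P' g^-1].
Proof.
move=> mP Ph; elim: F => [|f F [P' [mP' PP' P'h P'F]]]; first by exists P.
have [P2 [mP2 P'P2 P2h P2f]] := submonoid_extend f mP' P'h.
exists P2; split=> // [p /PP'/P'P2 //|g]; rewrite inE => /orP[/eqP -> //|/P'F].
by case=> /P'P2; [left|right].
Qed.

(** Start from the monoid generated by [x] and [y^-1].  If it misses all positive
    powers of some [h], it extends to a monoid that decides the signs in [F] and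
    still misses [h].  Otherwise the monoid meets the positive powers of every
    element: [x^-1] gives the first relation, [y] shows that a power of [y] is a
    power of [x], and then every [h] has a power that is a quotient of powers of
    [x]. *)
Lemma abelian_cone_or_rank_one x y F :
  (exists P, cone P x y F /\ exists h, ~ P h) \/
  ((exists p b, (0 < p)%N /\ x ^+ p = y ^+ b) /\
   forall h, exists k a b, (0 < k)%N /\ h ^+ k * x ^+ b = x ^+ a).
Proof.
pose P t := exists p q, [/\ exists n, p = x ^+ n, exists n, q = y^-1 ^+ n & t = p * q].
have mP : submonoid P by apply: submonoid_mul; exact: submonoid_powers.
have [[h Ph]|nP] := EM (exists h, forall k, (0 < k)%N -> ~ P (h ^+ k)).
  left; have [P' [mP' PP' P'h P'F]] := submonoid_extends F mP Ph.
  exists P'; split; last by exists h; rewrite -[h]expg1; exact: P'h.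
  split=> //; apply: PP'.
    by exists x, 1; split; rewrite ?mulg1 //; [exists 1%N|exists 0%N].
  by exists 1, y^-1; split; rewrite ?mul1g //; [exists 0%N|exists 1%N].
right.
have {nP} hP h : exists k a b, (0 < k)%N /\ h ^+ k * y ^+ b = x ^+ a.
  apply: contrapT => hP; apply: nP; exists h => k k0 [_ [_ [[a ->] [b ->] hk]]].
  by apply: hP; exists k, a, b; rewrite hk expVgn mulgVK.
split.
  have [k [a [b [k0 xk]]]] := hP x^-1; exists (k + a)%N, b.
  by rewrite addn_gt0 k0 expgnDr -xk expVgn mulVKg.
(* A positive power of y is a power of x, which eliminates y from hP. *)
have [q [c [d [q0 yq]]]] := hP y; move: yq; rewrite -expgnDr => yq h.
have [k [a [b [k0 hk]]]] := hP h.
exists (k * (q + d))%N, (a * (q + d))%N, (c * b)%N.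
rewrite muln_gt0 k0 addn_gt0 q0; split=> //.
rewrite [(c * b)%N]mulnC [in x ^+ (b * c)]mulnC !expgnA -yq -hk expgMn; last exact: abT.
by congr (_ * _); rewrite -!expgnA mulnC.
Qed.

Lemma abelian_cone x y F : torsion_free T -> x != 1 ->
  (forall p q, (0 < p)%N -> (0 < q)%N -> x ^+ p <> y ^+ q) ->
  exists P, cone P x y F /\ exists h, ~ P h.
Proof.
move=> tfT x1 xy; have [//|[[p [[|b] [p0 xp]]] _]] := abelian_cone_or_rank_one x y F.
  by rewrite (tfT x p p0 xp) eqxx in x1.
by case: (xy p b.+1).
Qed.

End Abelian.

End Cones.

Lemma cone_preim (T U : groupType) (f : UMagmaMorphism.type T U) (P : U -> Prop) x y F :
  cone P (f x) (f y) (map f F) -> cone (fun t => P (f t)) x y F.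
Proof.
case=> [[P1 PM] Px Py PF]; split=> //; rewrite ?gmulfV //.
  by split=> [|u v]; rewrite ?gmulf1 ?gmulfM //; exact: PM.
by move=> g gF; rewrite gmulfV; apply: PF; exact: map_f.
Qed.

Lemma nilpotent_cone (T : groupType) (x y : T) F : torsion_free T -> nilpotent T ->
  ~ abelian_group T -> exists P, cone P x y F /\ exists h, ~ P h.
Proof.
move=> tfT /nilpotent_hypercentral[n nT] nabT.
pose f := quot_pi (derived T).
have [[P [PF [h Ph]]]|[_ rk1]] :=
    abelian_cone_or_rank_one (quot_derived_abelian (T := T)) (f x) (f y) (map f F).
  exists (fun t => P (f t)); split; first exact: (cone_preim (f := quot_pi _)).
  by elim/quot_ind: h Ph => h Ph; exists h.
case: nabT; apply: (abelian_of_rank_one (n := n) (x := x)) => // h.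
have [k [a [b [k0 hk]]]] := rk1 (f h); exists k, a, b; split=> //.
apply/(quot_pi1P (derived T)); rewrite !gmulfM gmulfV !gmulfXn.
by rewrite hk mulVg.
Qed.

(** A cone that is proper on the subgroup generated by [F] cannot contain all
    of [F] among its units, for these form a subgroup. *)
Lemma cone_gen (Q : groupType) (F : seq Q) (x y : subg (gen [in F])) P :
  cone P x y (pmap insub F) -> (exists h, ~ P h) ->
  exists P', cone P' (val x) (val y) F /\ exists2 g, g \in F & ~ (P' g /\ P' g^-1).
Proof.
move=> [[P1 PM] Px Py PF] [h Ph].
pose P' q := exists2 t : subg (gen [in F]), P t & val t = q.
have P'1 : P' 1 by exists 1 => //; exact: gmulf1.
have P'M u v : P' u -> P' v -> P' (u * v).
  by move=> [s Ps <-] [t Pt <-]; exists (s * t); [exact: PM|exact: gmulfM].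
exists P'; split; first split=> //.
- by exists x.
- by exists y^-1 => //; exact: gmulfV.
- move=> g gF; have gH : g \in gen [in F] by exact: sub_gen.
  have [|Pg|Pg] := PF (Sub g gH).
  + by rewrite mem_pmap; apply/mapP; exists g => //; rewrite insubT.
  + by left; exists (Sub g gH).
  + by right; exists (Sub g gH)^-1 => //; rewrite gmulfV.
apply: contrapT => nF; apply: Ph.
have FP g : g \in [in F] -> P' g /\ P' g^-1.
  by move=> gF; apply: contrapT => ng; apply: nF; exists g.
have [[t Pt /val_inj <- //] _] : P' (val h) /\ P' (val h)^-1.
apply: (@gen_ind _ (fun q => P' q /\ P' q^-1) _ _ _ [in F]); last exact: valP.
- by rewrite invg1.
- by move=> u v [Pu Pu'] [Pv Pv']; rewrite invgM; split; exact: P'M.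
- by move=> u [Pu Pu']; rewrite invgK.
- exact: FP.
Qed.

(** * Cones in residually locally torsion-free nilpotent groups *)
Section Residual.

Lemma torsion_free_subg (Q : groupType) (H : groupClosed Q) :
  torsion_free Q -> torsion_free (subg H).
Proof.
move=> tfQ x n n0 xn; apply: val_inj; rewrite gmulf1; apply: (tfQ _ n n0).
by rewrite -gmulfXn xn gmulf1.
Qed.

Lemma commute_val (Q : groupType) (H : groupClosed Q) (x y : subg H) :
  commute (val x) (val y) <-> commute x y.
Proof.
split=> [xy|xy]; last by rewrite /commute -!gmulfM xy.
by apply: val_inj; rewrite !gmulfM.
Qed.

Lemma finitely_generated_seq (Q : groupType) (s : seq Q) :
  finitely_generated (GroupClosed.clone _ (gen [in s]) _).
Proof. by exists s. Qed.

Lemma gen_morph (T U : groupType) (f : UMagmaMorphism.type T U)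
    (A : {pred T}) (B : {pred U}) :
  (forall x, x \in A -> f x \in B) -> forall x, x \in gen A -> f x \in gen B.
Proof.
move=> AB; apply: (@gen_ind _ (fun x => f x \in gen B)).
- by rewrite gmulf1 gpred1.
- by move=> x y fx fy; rewrite gmulfM gpredM.
- by move=> x fx; rewrite gmulfV gpredV.
- by move=> x /AB; exact: sub_gen.
Qed.

Lemma commute_root_locally_nilpotent (Q : groupType) :
  torsion_free Q -> locally_nilpotent Q ->
  forall k (u v : Q), (0 < k)%N -> commute u (v ^+ k) -> commute u v.
Proof.
move=> tfQ lnQ k u v k0 uvk.
have [n nH] := nilpotent_hypercentral (lnQ _ (finitely_generated_seq [:: u; v])).
have uH : u \in gen [in [:: u; v]] by apply: sub_gen; rewrite !inE eqxx.
have vH : v \in gen [in [:: u; v]] by apply: sub_gen; rewrite !inE eqxx orbT.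
apply: (commute_val (Sub u uH) (Sub v vH)).2.
apply: (commute_root (torsion_free_subg tfQ) k0 (nH _)).
by apply: (commute_val _ _).1; rewrite gmulfXn.
Qed.

Variable G : groupType.
Hypothesis rG : residually_locally_torsion_free_nilpotent G.

Lemma residually_torsion_free : torsion_free G.
Proof.
move=> x n n0 xn; apply/eqP; apply: contrapT => /negP/rG[N [/negP xN tfN _]].
apply: xN; apply/(quot_pi1P N); apply: (tfN _ n n0).
by rewrite -gmulfXn xn gmulf1.
Qed.

(** If [F] generates an abelian group, then the coincidence of powers of [x] and
    [y] is the only obstruction to a cone.  Otherwise a nontrivial commutator of
    that group survives in some quotient by [N], where there is no obstruction,
    even if [x] and [y] die there, and the cone is pulled back to [G]. *)
Lemma residual_cone (F : seq G) (x y : G) : x \in F -> y \in F -> x != 1 ->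
  (forall p q, (0 < p)%N -> (0 < q)%N -> x ^+ p <> y ^+ q) ->
  exists P, cone P x y F /\ exists2 g, g \in F & ~ (P g /\ P g^-1).
Proof.
move=> xF yF x1 xy; have [abK|nabK] := EM (abelian_group (subg (gen [in F]))).
  have xK : x \in gen [in F] by exact: sub_gen.
  have yK : y \in gen [in F] by exact: sub_gen.
  pose x' : subg (gen [in F]) := Sub x xK; pose y' : subg (gen [in F]) := Sub y yK.
  have [P [PF nP]] : exists P, cone P x' y' (pmap insub F) /\ exists h, ~ P h.
    apply: abelian_cone => //.
    - exact/torsion_free_subg/residually_torsion_free.
    - by move=> p q p0 q0 /(congr1 val); rewrite !gmulfXn; exact: xy.
  exact: cone_gen PF nP.
have [a [b nab]] : exists a b : subg (gen [in F]), ~ commute a b.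
  apply: contrapT => nab; apply: nabK => a b; apply: contrapT => ab.
  by apply: nab; exists a, b.
have [N [abN tfN lnN]] : exists N : normalSubgroup G, [/\ [~ val a, val b] \notin
    normal_group N, torsion_free (quot N) & locally_nilpotent (quot N)].
  by apply: rG; apply/eqP => ab; apply/nab/commute_val/commgP/eqP.
pose F' := map (quot_pi N) F.
have memF' g : g \in gen [in F] -> quot_pi N g \in gen [in F'].
  by apply: gen_morph => h hF; exact: map_f.
pose lift g (gK : g \in gen [in F]) : subg (gen [in F']) :=
  Sub (quot_pi N g) (memF' g gK).
have xK : x \in gen [in F] by exact: sub_gen.
have yK : y \in gen [in F] by exact: sub_gen.
have [P [PF nP]] : exists P, cone P (lift x xK) (lift y yK) (pmap insub F') /\
    exists h, ~ P h.
  apply: nilpotent_cone.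
  - exact: torsion_free_subg.
  - exact: lnN (finitely_generated_seq _).
  - move=> /(_ (lift _ (valP a)) (lift _ (valP b)))/commute_val /= ab.
    move/negP: abN; apply; apply/(quot_pi1P N); rewrite gmulfR.
    exact/eqP/commgP.
have [P' [P'F [_ /mapP[g gF ->] nPg]]] := cone_gen PF nP.
exists (fun t => P' (quot_pi N t)); split; first exact: (cone_preim (f := quot_pi _)).
by exists g => //; rewrite gmulfV.
Qed.

End Residual.

(** * Choosing signs of finitely many elements *)
Section Orientations.
Variable G : groupType.
Implicit Types (x y g : G) (F s w : seq G).

(** The semigroup generated by [s] avoids 1: all of [s] may be declared
    positive. *)
Definition posfree s := forall w, w != [::] -> {subset w <= s} ->
  \prod_(g <- w) g <> 1.

Definition orients s F := forall g, g \in F -> g \in s \/ g^-1 \in s.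

Lemma posfree_sub s s' : {subset s <= s'} -> posfree s' -> posfree s.
Proof. by move=> ss' s'P w w0 ws; apply: s'P => // g /ws/ss'. Qed.

Lemma posfree_inv s : posfree s -> posfree [seq g^-1 | g <- s].
Proof.
move=> sP w w0 ws w1; apply: (sP (rev [seq g^-1 | g <- w])).
- by rewrite -size_eq0 size_rev size_map size_eq0.
- move=> g; rewrite mem_rev => /mapP[h /ws/mapP[k ks ->] ->].
  by rewrite invgK.
- apply: invg_inj; rewrite invg1 -[RHS]w1 -prodgV big_map.
  by apply: eq_bigr => g _; rewrite invgK.
Qed.

Lemma orients_inv s F : orients s F -> orients [seq g^-1 | g <- s] F.
Proof.
move=> sF g /sF[gs|gs]; [right|left]; first exact: (map_f (fun h : G => h^-1)).
by apply/mapP; exists g^-1; rewrite ?invgK.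
Qed.

Lemma submonoid_prod P w : submonoid P -> (forall g, g \in w -> P g) ->
  P (\prod_(g <- w) g).
Proof.
case=> P1 PM; elim: w => [|h w IH] wP; first by rewrite big_nil.
rewrite big_cons; apply: PM; first by apply: wP; rewrite inE eqxx.
by apply: IH => g gw; apply: wP; rewrite inE gw orbT.
Qed.

(** The units of [P], on which [P] decides no sign. *)
Definition lineal P g := `[< P g /\ P g^-1 >].

(** One step of the induction of Burns and Hale.  A product of elements of [P],
    one of which is not a unit, is not trivial: otherwise the inverse of that
    element would be the product of the others, in cyclic order.  Hence signs
    read off [P] on the non-units combine with any choice of signs on the
    units. *)
Lemma orient_step P F s0 : submonoid P -> (forall g, g \in F -> P g \/ P g^-1) ->
  orients s0 [seq g <- F | lineal P g] -> posfree s0 ->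
  exists s, [/\ orients s F, posfree s,
    forall g, g \in s0 -> lineal P g -> g \in s
    & forall g, g \in F \/ g^-1 \in F -> P g -> ~~ lineal P g -> g \in s].
Proof.
move=> mP PF s0F s0P; have [P1 PM] := mP.
pose s := [seq g <- s0 | lineal P g] ++
  [seq g <- F ++ [seq h^-1 | h <- F] | `[< P g /\ ~ P g^-1 >]].
have ls0 g : g \in s0 -> lineal P g -> g \in s.
  by move=> gs0 lg; rewrite mem_cat mem_filter lg gs0.
have strict g : g \in F \/ g^-1 \in F -> P g -> ~~ lineal P g -> g \in s.
  move=> gF Pg lg; rewrite mem_cat orbC mem_filter mem_cat.
  have -> : `[< P g /\ ~ P g^-1 >].
    by apply/asboolP; split=> // PgV; move/negP: lg; apply; apply/asboolP.
  by case: gF => [->//|/(map_f (fun h : G => h^-1))]; rewrite invgK => ->; rewrite orbT.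
exists s; split=> //.
- move=> g gF; have [lg|lg] := boolP (lineal P g).
    have [|gs0|gs0] := s0F g; first by rewrite mem_filter lg.
      by left; exact: ls0.
    by right; apply: ls0 => //; move/asboolP: lg => [? ?]; apply/asboolP; rewrite invgK.
  have [Pg|PgV] := PF g gF; [left|right]; apply: strict => //; first by left.
    by right; rewrite invgK.
  by move: lg; rewrite /lineal invgK; apply: contra => /asboolP[? ?]; apply/asboolP.
- move=> w w0 ws w1.
  have wP g : g \in w -> P g.
    by move=> /ws; rewrite mem_cat !mem_filter => /orP[] /andP[/asboolP[]].
  have [/allP wl|/allPn[g gw lg]] := boolP (all (lineal P) w).
    apply: (s0P w) => // g gw; have := ws g gw.
    rewrite mem_cat !mem_filter => /orP[/andP[]//|/andP[/asboolP[_ nP]]].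
    by have /asboolP[] := wl g gw.
  move/negP: lg; apply; apply/asboolP; split; first exact: wP.
  case/splitPr: gw w1 wP => w1 w2; rewrite big_cat big_cons /= => w1w2 wP.
  (* From w1 * g * w2 = 1, read cyclically. *)
  have -> : g^-1 = (\prod_(h <- w2) h) * \prod_(h <- w1) h.
    apply: mulg1_eq; set a := \prod_(h <- w1) h in w1w2 *.
    set b := \prod_(h <- w2) h in w1w2 *.
    by apply: (mulgI a); rewrite mulg1 !mulgA -[a * g * b]mulgA w1w2 mul1g.
  by apply: PM; apply: submonoid_prod => // h hw; apply: wP;
    rewrite mem_cat ?inE hw ?orbT.
Qed.

Hypothesis rG : residually_locally_torsion_free_nilpotent G.

(** Here the pair to be separated only serves to produce a cone: [f] and [f^-1]
    satisfy the hypothesis because [G] is torsion-free. *)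
Lemma orientable F : (forall g, g \in F -> g != 1) ->
  exists s, orients s F /\ posfree s.
Proof.
have [m] := ubnP (size F); elim: m F => // m IH F Fm F1.
case: F => [|f F] in Fm F1 *.
  by exists [::]; split=> // w w0 ws; case: w ws w0 => // g w /(_ g); rewrite inE eqxx => /(_ isT).
have f1 : f != 1 by apply: F1; rewrite inE eqxx.
have [||||P [[mP _ _ PF] [g gF ng]]] := @residual_cone _ rG (f^-1 :: f :: F) f f^-1.
- by rewrite !inE eqxx orbT.
- by rewrite inE eqxx.
- by [].
- move=> p q p0 q0; rewrite expVgn => fpq; move/eqP: f1; apply.
  apply: (residually_torsion_free rG (n := p + q)); first by rewrite addn_gt0 p0.
  by rewrite expgnDr fpq mulVg.
have {g gF ng} [g gF lg] : exists2 g, g \in f :: F & ~~ lineal P g.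
  move: gF; rewrite inE => /orP[/eqP gf|gF].
    exists f; rewrite ?inE ?eqxx //; apply/negP => /asboolP[Pf PfV].
    by apply: ng; rewrite gf invgK.
  by exists g => //; apply/negP => /asboolP.
have PF' h : h \in f :: F -> P h \/ P h^-1.
  by move=> hF; apply: PF; rewrite inE hF orbT.
have [||s0 [s0F s0P]] := IH [seq g <- f :: F | lineal P g].
- rewrite -ltnS; apply: leq_trans Fm; rewrite ltnS size_filter ltn_neqAle count_size andbT.
  by rewrite -all_count; apply/allPn; exists g.
- by move=> h; rewrite mem_filter => /andP[_ /F1].
have [s [sF sP _ _]] := orient_step mP PF' s0F s0P.
by exists s.
Qed.

(** Reversing all signs gives any one element the sign that is wanted. *)
Lemma orientable_mem F z : (forall g, g \in F -> g != 1) ->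
  z \in F \/ z^-1 \in F -> exists s, [/\ orients s F, posfree s & z \in s].
Proof.
move=> F1 zF; have [s [sF sP]] := orientable F1.
have [zs|zs] : z \in s \/ z^-1 \in s.
  by case: zF => /sF //; rewrite invgK => -[]; [right|left].
  by exists s.
exists [seq g^-1 | g <- s]; split; [exact: orients_inv|exact: posfree_inv|].
by rewrite -[z]invgK; exact: (map_f (fun h : G => h^-1)).
Qed.

(** When [x] and [y] are both units of the cone, the induction hypothesis
    separates them; when one of them is not, the cone gives it the right sign,
    and the signs on the units are adjusted to suit the other. *)
Lemma orientable_separating F x y : (forall g, g \in F -> g != 1) ->
  x \in F -> y \in F ->
  (forall p q, (0 < p)%N -> (0 < q)%N -> x ^+ p <> y ^+ q) ->
  exists s, [/\ orients s F, posfree s, x \in s & y^-1 \in s].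
Proof.
have [m] := ubnP (size F); elim: m F => // m IH F Fm F1 xF yF xy.
have [P [[mP Px Py PF] [g gF ng]]] := residual_cone rG xF yF (F1 x xF) xy.
pose F0 := [seq g <- F | lineal P g].
have F01 h : h \in F0 -> h != 1 by rewrite mem_filter => /andP[_ /F1].
have yV : lineal P y^-1 = lineal P y.
  by apply/asboolP/asboolP; rewrite invgK => -[].
have yF' : y^-1 \in F \/ (y^-1)^-1 \in F by right; rewrite invgK.
have [s0 [s0F s0P xs0 ys0]] : exists s0, [/\ orients s0 F0, posfree s0,
    lineal P x -> x \in s0 & lineal P y -> y^-1 \in s0].
  have [lx|lx] := boolP (lineal P x); have [ly|ly] := boolP (lineal P y).
  - have [|||||s [? ? ? ?]] := IH F0; last (by exists s); rewrite ?mem_filter ?lx ?ly //.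
    rewrite -ltnS; apply: leq_trans Fm; rewrite ltnS size_filter ltn_neqAle.
    rewrite count_size andbT -all_count; apply/allPn; exists g => //.
    by apply/negP => /asboolP.
  - have [|s [? ? ?]] := @orientable_mem F0 x F01; last by exists s.
    by left; rewrite mem_filter lx.
  - have [|s [? ? ?]] := @orientable_mem F0 y^-1 F01; last by exists s.
    by right; rewrite mem_filter invgK ly.
  - by have [s [? ?]] := orientable F01; exists s.
have [s [sF sP s0s Ps]] := orient_step mP PF s0F s0P.
exists s; split=> //.
  have [lx|lx] := boolP (lineal P x); first by apply: s0s => //; exact: xs0.
  by apply: Ps => //; left.
have [ly|ly] := boolP (lineal P y).
  by apply: s0s; rewrite ?yV //; exact: ys0.
by apply: Ps; rewrite ?yV.
Qed.

End Orientations.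

(** * From finite sets to orders *)
Section Compactness.
Variable G : groupType.
Implicit Types (x y g : G) (F s w : seq G).

(** Being positive on [s] is consistent with some choice of signs on any finite
    set. *)
Definition extendable s := forall F, (forall g, g \in F -> g != 1) ->
  exists s', orients s' F /\ posfree (s ++ s').

Lemma extendable_sub s s' : {subset s <= s'} -> extendable s' -> extendable s.
Proof.
move=> ss' s'E F F1; have [t [tF s't]] := s'E F F1; exists t; split=> //.
apply: posfree_sub s't => g; rewrite !mem_cat => /orP[/ss' ->//|->].
by rewrite orbT.
Qed.

Lemma extendable_posfree s : extendable s -> posfree s.
Proof.
by case/(_ [::]) => // t [_]; apply: posfree_sub => g; rewrite mem_cat => ->.
Qed.

(** If [F1] obstructed [g] and [F2] obstructed [g^-1], then no sign of [g] would
    be possible in a choice of signs for [g], [F1] and [F2] together. *)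
Lemma extendable_cons s g : extendable s -> g != 1 ->
  extendable (g :: s) \/ extendable (g^-1 :: s).
Proof.
move=> sE g1; apply: contrapT => nE.
have nE' h : ~ extendable (h :: s) -> exists F, (forall k, k \in F -> k != 1) /\
    forall t, orients t F -> ~ posfree (h :: s ++ t).
  move=> nh; apply: contrapT => nF; apply: nh => F F1; apply: contrapT => nt.
  by apply: nF; exists F; split=> // t tF htP; apply: nt; exists t.
have [|F1 [F11 nF1]] := nE' g; first by move=> ?; apply: nE; left.
have [|F2 [F21 nF2]] := nE' g^-1; first by move=> ?; apply: nE; right.
have [|t [tF stP]] := sE (g :: F1 ++ F2).
  by move=> h; rewrite inE mem_cat => /orP[/eqP->|/orP[/F11|/F21]].
have tF1 : orients t F1 by move=> h hF; apply: tF; rewrite inE mem_cat hF orbT.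
have tF2 : orients t F2 by move=> h hF; apply: tF; rewrite inE mem_cat hF !orbT.
have sub h : h \in t -> posfree (h :: s ++ t).
  move=> ht; apply: posfree_sub stP => k; rewrite inE => /orP[/eqP->|//].
  by rewrite mem_cat ht orbT.
have [gt|gt] : g \in t \/ g^-1 \in t by apply: tF; rewrite inE eqxx.
  exact: (nF1 t tF1 (sub _ gt)).
exact: (nF2 t tF2 (sub _ gt)).
Qed.

Lemma total_on_seq (C : set (set G)) (s : seq G) : total_on C subset ->
  (forall g, g \in s -> (\bigcup_(X in C) X)%classic g) ->
  s = [::] \/ exists2 X, C X & forall g, g \in s -> X g.
Proof.
move=> totC; elim: s => [|g s IH] sC; first by left.
right; have [|X CX Xg] := sC g; first by rewrite inE eqxx.
have [|->|[Y CY Ys]] := IH.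
- by move=> h hs; apply: sC; rewrite inE hs orbT.
- by exists X => // h; rewrite inE => /eqP->.
have [XY|YX] := totC _ _ CX CY.
  by exists Y => // h; rewrite inE => /orP[/eqP->|/Ys//]; exact: XY.
by exists X => // h; rewrite inE => /orP[/eqP->//|/Ys]; exact: YX.
Qed.

(** A maximal set all of whose finite subsets, joined to [s0], are extendable is
    the positive cone of a left order. *)
Lemma extendable_order s0 : extendable s0 ->
  exists o : LO G, forall g, g \in s0 -> o 1 g.
Proof.
move=> s0E.
pose E (A : set G) := forall s, (forall g, g \in s -> A g) -> extendable (s0 ++ s).
have [A [EA maxA]] : exists A, E A /\ forall B, (A `<` B)%classic -> ~ E B.
  apply: Zorn_bigcup => C CE totC s sC.
  have [->|[X CX Xs]] := total_on_seq totC sC; first by rewrite cats0.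
  exact: (CE X CX s Xs).
have prodA w : w != [::] -> (forall g, g \in w -> g \in s0 \/ A g) ->
    \prod_(g <- w) g <> 1.
  move=> w0 wA; pose wA' := [seq g <- w | `[< A g >]].
  have : extendable (s0 ++ wA').
    by apply: EA => g; rewrite mem_filter => /andP[/asboolP].
  move/extendable_posfree; apply=> // g gw; rewrite mem_cat mem_filter gw andbT.
  by have [->//|Ag] := wA g gw; rewrite orbC; apply/orP; left; apply/asboolP.
have notE h : ~ A h -> exists2 s, (forall g, g \in s -> A g) &
    ~ extendable (h :: s0 ++ s).
  move=> nAh; apply: contrapT => nE; apply: (maxA (A `|` [set h])%classic).
    by split=> [g Ag|sub]; [left|apply/nAh/sub; right].
  move=> s sA; have : extendable (h :: s0 ++ [seq g <- s | `[< A g >]]).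
    apply: contrapT => nEs; apply: nE; exists [seq g <- s | `[< A g >]] => // g.
    by rewrite mem_filter => /andP[/asboolP].
  apply: extendable_sub => g; rewrite mem_cat inE mem_cat mem_filter.
  move=> /orP[->|gs]; first by rewrite orbT.
  case: (sA g gs) => [Ag|/= ->]; last by rewrite eqxx.
  have -> : `[< A g >] by apply/asboolP.
  by rewrite gs !orbT.
have totA g : g != 1 -> A g \/ A g^-1.
  move=> g1; apply: contrapT => nA.
  have [|s sA nEs] := notE g; first by move=> ?; apply: nA; left.
  have [|t tA nEt] := notE g^-1; first by move=> ?; apply: nA; right.
  have [||] := @extendable_cons (s0 ++ s ++ t) g _ g1.
  - by apply: EA => h; rewrite mem_cat => /orP[/sA|/tA].
  - move=> H; apply: nEs; apply: extendable_sub H => h.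
    by rewrite !inE !mem_cat => /orP[->//|/orP[->|->]]; rewrite !orbT.
  - move=> H; apply: nEt; apply: extendable_sub H => h.
    by rewrite !inE !mem_cat => /orP[->//|/orP[->|->]]; rewrite !orbT.
have A1 : ~ A 1.
  move=> A1; apply: (prodA [:: 1]) => //; last by rewrite big_seq1.
  by move=> g; rewrite inE => /eqP->; right.
have sA g h : g \in s0 \/ A g -> h \in s0 \/ A h -> A (g * h).
  move=> Ag Ah; have gh1 : g * h != 1.
    apply/eqP => gh; apply: (prodA [:: g; h]) => //; last by rewrite big_cons big_seq1.
    by move=> k; rewrite !inE => /orP[] /eqP->.
  have [//|Agh] := totA _ gh1; case: (prodA [:: g; h; (g * h)^-1]) => //.
    by move=> k; rewrite !inE => /or3P[] /eqP-> //; right.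
  by rewrite !big_cons big_nil mulg1 mulgA mulgV.
have s0A g : g \in s0 -> A g.
  move=> gs; have [|//|AgV] := totA g.
    apply/eqP => g1; apply: (prodA [:: g]) => //; last by rewrite big_seq1.
    by move=> k; rewrite !inE => /eqP->; left.
  case: (prodA [:: g; g^-1]) => //.
    by move=> k; rewrite !inE => /orP[] /eqP-> //; [left|right].
  by rewrite big_cons big_seq1 mulgV.
pose lt : rel G := fun x y => `[< A (x^-1 * y) >].
have irr : irreflexive lt by move=> x; apply/asboolP; rewrite mulVg.
have trans : transitive lt.
  move=> y x z /asboolP xy /asboolP yz; apply/asboolP.
  have -> : x^-1 * z = (x^-1 * y) * (y^-1 * z) by rewrite !gnorm.
  by apply: sA; right.
have total x y : x != y -> lt x y || lt y x.
  move=> xy; have [|xyA|yxA] := totA (x^-1 * y).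
  - by apply: contraNneq xy => /mulg1_eq; rewrite invgK => ->.
  - by apply/orP; left; apply/asboolP.
  - by apply/orP; right; apply/asboolP; move: yxA; rewrite invgM invgK.
have left_inv g x y : lt x y -> lt (g * x) (g * y).
  by move=> /asboolP xy; apply/asboolP; rewrite invgM -mulgA mulKg.
exists (LeftOrder irr trans total left_inv) => g /s0A Ag.
by apply/asboolP; rewrite invg1 mul1g.
Qed.

End Compactness.

(** A coincidence of positive powers of [x] and [y] forces them to have the same
    sign in every left order, and it is the only obstruction to separating
    them. *)
Theorem exists_separating_order (G : groupType) (x y : G) :
  residually_locally_torsion_free_nilpotent G -> x != 1 -> y != 1 ->
  (forall p q, (0 < p)%N -> (0 < q)%N -> x ^+ p <> y ^+ q) ->
  exists o : LO G, o 1 x /\ o 1 y^-1.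
Proof.
move=> rG x1 y1 xy.
have [|o oP] := @extendable_order G [:: x; y^-1].
  move=> F F1; have [||||s [sF sP xs ys]] := @orientable_separating _ rG [:: x, y & F] x y.
  - by move=> g; rewrite !inE => /or3P[/eqP->|/eqP->|/F1].
  - by rewrite inE eqxx.
  - by rewrite !inE eqxx orbT.
  - by [].
  exists s; split.
    by move=> g gF; apply: sF; rewrite !inE gF !orbT.
  by apply: posfree_sub sP => g; rewrite !inE => /or3P[/eqP->|/eqP->|].
by exists o; split; apply: oP; rewrite !inE eqxx ?orbT.
Qed.

(** * Morphisms that agree up to powers *)
Section UniqueRoots.
Variable T : groupType.
Hypothesis tfT : torsion_free T.
Hypothesis rootT : forall k (u v : T), (0 < k)%N -> commute u (v ^+ k) -> commute u v.
Implicit Types u v : T.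

Lemma expg_inj k u v : (0 < k)%N -> u ^+ k = v ^+ k -> u = v.
Proof.
move=> k0 uvk; have uv : commute u v.
  by apply: (rootT k0); rewrite -uvk; exact/commuteX/commute_refl.
by apply/divg1_eq/(tfT k0); rewrite expgnFl // uvk mulgV.
Qed.

Lemma expg_exp_inj u m n : u <> 1 -> u ^+ m = u ^+ n -> m = n.
Proof.
move=> u1; wlog mn : m n / (m <= n)%N => [W|].
  by case/orP: (leq_total m n) => [/W//|/W E /esym/E].
move=> umn; apply/eqP; rewrite eqn_leq mn /= leqNgt; apply/negP => lt_mn.
apply: u1; apply: (@tfT _ (n - m)%N); first by rewrite subn_gt0.
by rewrite expgnFr // umn mulgV.
Qed.

Lemma commute_root2 j k u v : (0 < j)%N -> (0 < k)%N ->
  commute (u ^+ j) (v ^+ k) -> commute u v.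
Proof.
move=> j0 k0 uv; apply: commute_sym; apply: (rootT j0).
exact/commute_sym/(rootT k0).
Qed.

Lemma commute_commg_pow m n u v : commute [~ u, v] u -> commute [~ u, v] v ->
  [~ u ^+ m, v ^+ n] = [~ u, v] ^+ (m * n).
Proof.
move=> zu zv.
have um : [~ u ^+ m, v] = [~ u, v] ^+ m.
  rewrite commgEl conjXg; have -> : u ^ v = u * [~ u, v] by rewrite commgEl mulVKg.
  by rewrite expgMn ?mulKg //; exact: commute_sym.
have mv : commute ([~ u ^+ m, v]) v by rewrite um; exact/commute_sym/commuteX/commute_sym.
rewrite expgnA -um; move: (u ^+ m) mv => w wv.
rewrite commgEl; suff -> : w ^ (v ^+ n) = w * [~ w, v] ^+ n by rewrite mulKg.
elim: n => [|n IH]; first by rewrite conjg1 mulg1.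
rewrite expgSr conjgM IH conjMg conjXg.
have -> : [~ w, v] ^ v = [~ w, v] by rewrite conjgE wv mulKg.
have -> : w ^ v = w * [~ w, v] by rewrite commgEl mulVKg.
by rewrite -mulgA -expgS.
Qed.

Lemma power_relation (u v : T) m n m' n' : (m < m')%N ->
  u ^+ m * v ^+ n = u ^+ m' * v ^+ n' ->
  exists i j, (0 < i)%N /\ (u ^+ i = v ^+ j \/ u ^+ i = v^-1 ^+ j).
Proof.
move=> mm'; rewrite -{1}(subnKC (ltnW mm')) expgnDr -mulgA => /mulgI uv.
exists (m' - m)%N; move: uv; have [n'n|nn'] := leqP n' n.
  rewrite -{1}(subnK n'n) expgnDr => /mulIg uv; exists (n - n')%N.
  by rewrite subn_gt0; split=> //; left.
rewrite -{1}(subnK (ltnW nn')) expgnDr mulgA -{1}[v ^+ n]mul1g => /mulIg uv.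
exists (n' - n)%N; rewrite subn_gt0; split=> //; right.
by rewrite expVgn; apply: (mulIg (v ^+ (n' - n))); rewrite mulVg.
Qed.

Section Ratio.
Variables (D : groupType) (f g : UMagmaMorphism.type D T).
Hypothesis fg : forall x, exists p q, [/\ (0 < p)%N, (0 < q)%N & g x ^+ p = f x ^+ q].

Lemma ratio_ker x : g x = 1 -> f x = 1.
Proof.
move=> gx; have [p [q [p0 q0]]] := fg x; rewrite gx expg1n => fx.
exact: (tfT q0).
Qed.

Lemma ratio_eq x y : g x = g y -> f x = f y.
Proof.
move=> gxy; apply: divg1_eq; rewrite -gmulfF; apply: ratio_ker.
by rewrite gmulfF gxy mulgV.
Qed.

(** Bring the relations for [x] and [y] to a common exponent [d] on the side of
    [f], say [g x ^+ a = f x ^+ d] and [g y ^+ b = f y ^+ d]; the claim is that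
    [g y ^+ a = g y ^+ b].  The relation for [x * y] compares two products of
    powers of [g x] and [g y].  Either their exponents at [g x] agree, and then
    so do those at [g y]; or a power of [g x] is a power of [g y] or of its
    inverse, and [a = b] follows by raising this relation to the power [a] and
    its image under [f] to the power [d]. *)
Lemma ratio_commute x y p q : (0 < p)%N -> (0 < q)%N ->
  commute (g x) (g y) -> g x <> 1 ->
  g x ^+ p = f x ^+ q -> g y ^+ p = f y ^+ q.
Proof.
move=> p0 q0 gxy gx1 gx.
have [s [t [s0 t0 gy]]] := fg y; have [c [e [c0 e0 gz]]] := fg (x * y).
have fxy : commute (f x) (f y).
  apply: (commute_root2 q0 t0); rewrite -gx -gy; exact: commuteX2.
pose a := (p * t)%N; pose b := (s * q)%N; pose d := (q * t)%N.
(* Both relations with the exponent d on the side of f. *)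
have a_gx : g x ^+ a = f x ^+ d by rewrite !expgnA gx.
have b_gy : g y ^+ b = f y ^+ d by rewrite /d mulnC !expgnA gy.
suff ab : g y ^+ a = g y ^+ b.
  by apply: (expg_inj t0); rewrite -!expgnA -/a ab b_gy.
clearbody a b d.
have rel : g x ^+ (a * e) * g y ^+ (b * e) = g x ^+ (c * d) * g y ^+ (c * d).
  rewrite -(expgMn _ gxy) expgnA -gmulfM gz -expgnA gmulfM [(e * d)%N]mulnC.
  by rewrite (expgMn _ fxy) !expgnA a_gx b_gy.
have [aecd|ne] := eqVneq (a * e)%N (c * d)%N.
  move: rel; rewrite -aecd => /mulgI; rewrite !expgnA => /(expg_inj e0).
  by move->.
have [i [j [i0 uv]]] : exists i j, (0 < i)%N /\
    (g x ^+ i = g y ^+ j \/ g x ^+ i = (g y)^-1 ^+ j).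
  move: ne; rewrite neq_ltn => /orP[] lt; first exact: power_relation lt rel.
  exact: power_relation lt (esym rel).
(* Replacing y by y^-1 if need be, a power of g x is a power of g w. *)
have [w [gxw wab]] : exists w, g x ^+ i = g w ^+ j /\
    [/\ g w ^+ b = f w ^+ d & g w ^+ a = g w ^+ b -> g y ^+ a = g y ^+ b].
  case: uv => uv; first by exists y.
  exists y^-1; rewrite !gmulfV !expVgn uv expVgn b_gy; split=> //; split=> //.
  by move/invg_inj.
have [b_gw] := wab; apply.
have j0 : (0 < j)%N.
  by case: j {uv} gxw => // gxi; case: gx1; apply: (tfT i0).
apply: (expg_inj j0); rewrite -!expgnA [(a * j)%N]mulnC [(b * j)%N]mulnC !expgnA.
have fxw : f x ^+ i = f w ^+ j.
  by rewrite -!gmulfXn; apply: ratio_eq; rewrite !gmulfXn.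
rewrite -{1}gxw [LHS]expgnAC a_gx [LHS]expgnAC fxw.
by rewrite [LHS]expgnAC -b_gw [LHS]expgnAC.
Qed.

End Ratio.
End UniqueRoots.

Section NilpotentRatio.
Variables (D T : groupType) (f g : UMagmaMorphism.type D T).
Hypotheses (tfT : torsion_free T) (lnT : locally_nilpotent T).
Hypothesis fg : forall x, exists p q, [/\ (0 < p)%N, (0 < q)%N & g x ^+ p = f x ^+ q].

Let rootT k (u v : T) : (0 < k)%N -> commute u (v ^+ k) -> commute u v.
Proof. exact: commute_root_locally_nilpotent. Qed.

(** Elements of the subgroup generated by values of [g] are values of [g], so
    that the relation with [f] is available for them. *)
Lemma gen_lift (s : seq D) (u : T) : u \in gen [in map g s] -> exists x, g x = u.
Proof.
apply: (@gen_ind _ (fun u => exists x, g x = u)).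
- by exists 1; exact: gmulf1.
- by move=> _ _ [x <-] [y <-]; exists (x * y); exact: gmulfM.
- by move=> _ [x <-]; exists x^-1; exact: gmulfV.
- by move=> _ /mapP[x _ ->]; exists x.
Qed.

(** The subgroup generated by [g x] and [g y] is nilpotent, hence has a
    nontrivial central element, which commutes with both. *)
Lemma ratio_constant x y p q : (0 < p)%N -> (0 < q)%N -> g x <> 1 ->
  g x ^+ p = f x ^+ q -> g y ^+ p = f y ^+ q.
Proof.
move=> p0 q0 gx1 gx; have [gy1|/eqP gy1] := eqVneq (g y) 1.
  by rewrite (ratio_ker tfT fg gy1) gy1 !expg1n.
pose L := gen [in map g [:: x; y]].
have xL : g x \in L by apply/sub_gen/map_f; rewrite !inE eqxx.
have yL : g y \in L by apply/sub_gen/map_f; rewrite !inE eqxx orbT.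
have [n nL] := nilpotent_hypercentral (lnT (finitely_generated_seq (map g [:: x; y]))).
have [z [zc z1]] : exists z : subg L, hypercentral 1 z /\ z <> 1.
  apply: contrapT => nz; apply: gx1.
  suff /(congr1 val) : (Sub (g x) xL : subg L) = 1 by rewrite gmulf1.
  apply: (@hypercentral_stable _ 0 n); last by rewrite addn0; exact: nL.
  by move=> u u1; apply: contrapT => nu; apply: nz; exists u.
have {}zc t (tL : t \in L) : commute (val z) t.
  apply: (commute_val z (Sub t tL)).2; exact: (hypercentral1 z).1.
have [w gw] := gen_lift (valP z).
have gw1 : g w <> 1 by rewrite gw => zv; apply/z1/val_inj; rewrite gmulf1.
have w_ratio : g w ^+ p = f w ^+ q.
  apply: (ratio_commute tfT rootT fg p0 q0 _ gx1 gx).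
  by rewrite gw; exact/commute_sym/zc.
by apply: (ratio_commute tfT rootT fg p0 q0 _ gw1 w_ratio); rewrite gw; exact: zc.
Qed.

(** In a nonabelian nilpotent group, an element [u] of the second term of the
    upper central series outside the center has a nontrivial central commutator
    [z] with some [v].  Then [[~ u ^+ p, v ^+ p] = z ^+ (p * p)], while the
    relation between [f] and [g] turns it into [z ^+ (p * q)]. *)
Lemma ratio_one a b p q : (0 < p)%N -> (0 < q)%N ->
  (forall x, g x ^+ p = f x ^+ q) -> ~ commute (g a) (g b) -> p = q.
Proof.
move=> p0 q0 gf nab; pose L := gen [in map g [:: a; b]].
have aL : g a \in L by apply/sub_gen/map_f; rewrite !inE eqxx.
have bL : g b \in L by apply/sub_gen/map_f; rewrite !inE eqxx orbT.
have [n nL] := nilpotent_hypercentral (lnT (finitely_generated_seq (map g [:: a; b]))).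
have [u [u2 u1]] : exists u : subg L, hypercentral 2 u /\ ~ hypercentral 1 u.
  apply: contrapT => nu; apply: nab.
  apply: (commute_val (Sub (g a) aL : subg L) (Sub (g b) bL)).2.
  apply: (hypercentral1 _).1; apply: (@hypercentral_stable _ 1 n) => [w w2|].
    by apply: contrapT => w1; apply: nu; exists w.
  by rewrite addn1 => h; exact: nL.
have [v uv] : exists v, [~ u, v] <> 1.
  by apply: contrapT => nv; apply: u1 => v; apply: contrapT => w; apply: nv; exists v.
have zc : forall h, commute [~ u, v] h by apply/hypercentral1; exact: u2.
have [x gx] := gen_lift (valP u); have [y gy] := gen_lift (valP v).
have gz : g [~ x, y] = val [~ u, v] by rewrite !gmulfR gx gy.
have gz1 : g [~ x, y] <> 1 by rewrite gz => zv; apply/uv/val_inj; rewrite gmulf1.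
have gzx : commute (g [~ x, y]) (g x) by rewrite gz gx; apply/commute_val.
have gzy : commute (g [~ x, y]) (g y) by rewrite gz gy; apply/commute_val.
have f_comm t : commute (g [~ x, y]) (g t) -> commute (f [~ x, y]) (f t).
  move=> c; apply: (commute_root2 rootT q0 q0); rewrite -!gf; exact: commuteX2.
have E : [~ g x ^+ p, g y ^+ p] = [~ f x ^+ q, f y ^+ q] by rewrite !gf.
rewrite !(commute_commg_pow _ _ (u := _)) -?gmulfR in E; last first.
  all: try exact: f_comm.
  all: try done.
move: E; rewrite [f _ ^+ _]expgnA -gf -expgnA => /(expg_exp_inj tfT gz1)/eqP.
by rewrite eqn_pmul2l // => /eqP.
Qed.

End NilpotentRatio.

(** * Orders fixed by a commensuration *)
Section SignPreservation.
Variable G : groupType.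
Implicit Types (o : LO G) (x : G).

Lemma lo_expg o x n : (0 < n)%N -> o 1 x -> o 1 (x ^+ n).
Proof.
case: n => // n _ ox; elim: n => [|n IH]; first by rewrite expg1.
apply: (lo_trans ox); rewrite -{1}[x]mulg1 expgS; exact: lo_left.
Qed.

Lemma lo_inv o x : o 1 x = o x^-1 1.
Proof.
apply/idP/idP => [/(@lo_left _ o x^-1)|/(@lo_left _ o x)].
  by rewrite mulg1 mulVg.
by rewrite mulg1 mulgV.
Qed.

Lemma lo_root o x n : (0 < n)%N -> o 1 (x ^+ n) -> o 1 x.
Proof.
move=> n0 oxn; have x1 : x != 1.
  by apply: contraTneq oxn => ->; rewrite expg1n lo_irr.
case/orP: (lo_total o x1) => // ox.
have : o 1 (x^-1 ^+ n) by apply: lo_expg => //; rewrite lo_inv invgK.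
rewrite expVgn lo_inv invgK => /(lo_trans oxn).
by rewrite lo_irr.
Qed.

(** Two powers of [x] lie in the same coset of [H]. *)
Lemma finite_index_expg (H : fiSubgroup G) x :
  exists2 n, (0 < n)%N & x ^+ n \in fi_group H.
Proof.
have /finite_indexP[s sP] := fi_index H.
pose Y i := s2val (cid2 (sP (x ^+ i))).
have Ys i : Y i \in s by rewrite /Y; case: cid2.
have YH i : (Y i)^-1 * x ^+ i \in fi_group H by rewrite /Y; case: cid2.
have : ~~ uniq (map Y (iota 0 (size s).+1)).
  apply/negP => /uniq_leq_size le_size.
  have : {subset map Y (iota 0 (size s).+1) <= s} by move=> _ /mapP[i _ ->].
  by move/le_size; rewrite size_map size_iota ltnn.
case/(uniqPn 1) => i [j [ij]]; rewrite size_map size_iota => js.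
rewrite !(nth_map 0%N) ?size_iota ?(ltn_trans ij) // !nth_iota ?(ltn_trans ij) //.
rewrite !add0n => Yij; exists (j - i)%N; first by rewrite subn_gt0.
have -> : x ^+ (j - i) = ((Y i)^-1 * x ^+ i)^-1 * ((Y j)^-1 * x ^+ j).
  by rewrite Yij invgM invgK -mulgA mulVKg -{2}(subnKC (ltnW ij)) expgnDr mulKg.
by rewrite gpredM // gpredV.
Qed.

(** A power of [phi x] lies in the subgroup where [o] and its image agree, and
    there it has the sign of the same power of [x]. *)
Lemma fixed_order_sign (phi : commensuration G) o x :
  vlo_act (vlo_of o) (comm_pi phi) = vlo_of o ->
  x \in comm_dom phi -> o 1 x -> o 1 (comm_ext phi x).
Proof.
pose p : vorder G := @VOrder G (fi_full G)
  (lo_pullback (f := (val : {multiplicative subg (fi_full G) -> G})) val_inj o).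
have pE a b : vo_ext p a b = o a b.
  exact: (@vo_extE _ p (Sub a isT) (Sub b isT)).
rewrite [vlo_of o]/(vlo_pi p) vlo_actE => /vlo_piP/vo_eqP[H [_ _ HE]] xD ox.
have [n n0 xn] := finite_index_expg H (comm_ext phi x).
have D1 : 1 \in comm_dom phi by exact: gpred1.
have DX k : x ^+ k \in comm_dom phi by exact: gpredXn.
have phiX k : comm_ext phi (x ^+ k) = comm_ext phi x ^+ k.
  elim: k => [|k IH]; first exact: comm_ext1.
  by rewrite !expgS comm_extM // IH.
apply: (lo_root n0); rewrite -pE -HE ?gpred1 // -phiX -(comm_ext1 phi).
by rewrite vo_act_ext // pE; exact: lo_expg.
Qed.

End SignPreservation.

Lemma multiplicative_monoid_morphism (D T : groupType)
  (f : {multiplicative D -> T}) : monoid_morphism f.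
Proof.
split; last exact: gmulfM.
by apply: (mulgI (f 1)); rewrite -gmulfM !mulg1.
Qed.

(** A multiplicative map between groups preserves 1; this repackages it so that
    the theory of morphisms of groups applies. *)
Definition group_morphism (D T : groupType) (f : {multiplicative D -> T}) :
  UMagmaMorphism.type D T :=
  HB.pack (f : D -> T) (isUMagmaMorphism.Build D T f (multiplicative_monoid_morphism f)).

Section FixingAllOrders.
Variables (G : groupType) (phi : commensuration G).
Hypothesis rG : residually_locally_torsion_free_nilpotent G.
Hypothesis nabG : ~ abelian_group G.
Hypothesis fixO : forall o : LO G, vlo_act (vlo_of o) (comm_pi phi) = vlo_of o.

(** Otherwise some order would give [x] and [phi x] opposite signs. *)
Lemma comm_ext_power x : x \in comm_dom phi ->
  exists p q, [/\ (0 < p)%N, (0 < q)%N & x ^+ p = comm_ext phi x ^+ q].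
Proof.
move=> xD; have [->|x1] := eqVneq x 1.
  by exists 1%N, 1%N; rewrite comm_ext1.
apply: contrapT => npq; have [|p q p0 q0 xpq|o [ox oy]] :=
    @exists_separating_order G x (comm_ext phi x) rG x1.
- apply: contra_neq x1 => y1; apply: (@comm_ext_inj _ phi) => //.
    exact: gpred1.
  by rewrite y1 comm_ext1.
- by apply: npq; exists p, q.
have := fixed_order_sign (fixO o) xD ox.
by rewrite -[comm_ext phi x]invgK lo_inv !invgK => /(lo_trans oy); rewrite lo_irr.
Qed.

Section Quotient.
Variable N : normalSubgroup G.

(** The projection modulo [N] and its composite with [phi], both as morphisms on
    the domain of [phi]. *)
Definition dom_pi : UMagmaMorphism.type (subg (comm_dom phi)) (quot N) :=
  group_morphism (quot_pi N \o val).
Definition cod_pi : UMagmaMorphism.type (subg (comm_dom phi)) (quot N) :=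
  group_morphism (quot_pi N \o (val \o comm_map phi)).

Lemma dom_cod_power x : exists p q,
  [/\ (0 < p)%N, (0 < q)%N & dom_pi x ^+ p = cod_pi x ^+ q].
Proof.
have [p [q [p0 q0 xpq]]] := comm_ext_power (valP x); exists p, q; split=> //.
by rewrite /= -!gmulfXn xpq comm_extE.
Qed.

Hypotheses (tfN : torsion_free (quot N)) (lnN : locally_nilpotent (quot N)).

(** The domain of [phi] contains powers of [a] and [b], which do not commute
    modulo [N] because roots preserve commutation. *)
Lemma dom_pi_nonabelian (a b : G) : [~ a, b] \notin normal_group N ->
  exists x y, ~ commute (dom_pi x) (dom_pi y).
Proof.
move=> abN.
have [m m0 am] := finite_index_expg (comm_dom phi) a.
have [n n0 bn] := finite_index_expg (comm_dom phi) b.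
exists (Sub (a ^+ m) am), (Sub (b ^+ n) bn) => /= abc.
move/negP: abN; apply; apply/(quot_pi1P N); rewrite gmulfR.
apply/eqP/commgP; have rootN := commute_root_locally_nilpotent tfN lnN.
by apply: (commute_root2 rootN m0 n0); rewrite -!gmulfXn.
Qed.

Lemma dom_pi_eq_cod_pi w p : (0 < p)%N -> dom_pi w <> 1 ->
  dom_pi w ^+ p = cod_pi w ^+ p -> forall x, dom_pi x = cod_pi x.
Proof.
move=> p0 w1 wp x; have rootN := commute_root_locally_nilpotent tfN lnN.
apply: (expg_inj tfN rootN p0); exact: (ratio_constant tfN lnN dom_cod_power _ p0 p0 w1 wp).
Qed.

End Quotient.

(** In a nonabelian quotient by [N] the ratio is 1, so [phi] is trivial modulo
    [N].  If [phi x] and [x] differed modulo some other [M], an element [w] that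
    is nontrivial modulo both [M] and [N] would carry the ratio 1 over to the
    quotient by [M]. *)
Lemma comm_ext_fixed : {in comm_dom phi, forall x, comm_ext phi x = x}.
Proof.
have [a [b nab]] : exists a b : G, ~ commute a b.
  apply: contrapT => nab; apply: nabG => a b; apply: contrapT => ab.
  by apply: nab; exists a, b.
have [|N [abN tfN lnN]] := rG (g := [~ a, b]).
  by apply: (introN _ nab); exact: commgP.
have [c [d ncd]] := dom_pi_nonabelian tfN lnN abN.
have c1 : dom_pi N c <> 1.
  by move=> c1; apply: ncd; rewrite c1; exact/commute_sym/commute1.
have [p [q [p0 q0 cpq]]] := dom_cod_power N c.
have Npq x : dom_pi N x ^+ p = cod_pi N x ^+ q.
  exact: (ratio_constant tfN lnN (dom_cod_power N) _ p0 q0 c1).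
have pq := ratio_one tfN lnN p0 q0 Npq ncd.
have Nfix x : dom_pi N x = cod_pi N x.
  apply: (dom_pi_eq_cod_pi tfN lnN p0 c1); by rewrite Npq pq.
move=> x xD; apply/eqP; apply: contrapT => nx.
pose x' : subg (comm_dom phi) := Sub x xD.
have [M [xM tfM lnM]] : exists M : normalSubgroup G, [/\
    x^-1 * comm_ext phi x \notin normal_group M, torsion_free (quot M)
    & locally_nilpotent (quot M)].
  apply: rG; apply/eqP => /mulg1_eq; rewrite invgK => xE; apply: nx.
  by rewrite -xE.
have nfix : dom_pi M x' <> cod_pi M x'.
  have := comm_extE x' => /= xE.
  by move=> /quot_piP; rewrite /= -xE => xM'; move: xM; rewrite xM'.
have x1 : dom_pi M x' <> 1.
  move=> x1; apply: nfix; rewrite x1.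
  by rewrite (ratio_ker tfM (dom_cod_power M) x1).
(* If x' dies modulo N and c modulo M, their product dies in neither. *)
have [w [wM wN]] : exists w, dom_pi M w <> 1 /\ dom_pi N w <> 1.
  have [xN|] := EM (dom_pi N x' = 1); last by exists x'.
  have [cM|] := EM (dom_pi M c = 1); last by exists c.
  by exists (x' * c); rewrite !gmulfM xN cM mul1g mulg1.
have [s [t [s0 t0 wst]]] := comm_ext_power (valP w).
have st : s = t.
  apply: (expg_exp_inj tfN wN); rewrite {2}Nfix.
  by rewrite /= -!gmulfXn wst comm_extE.
apply: nfix; apply: (dom_pi_eq_cod_pi tfM lnM s0 wM).
by rewrite /= -!gmulfXn wst st comm_extE.
Qed.

End FixingAllOrders.

Theorem corollary1p8 (G : groupType) (alpha : Comm G) :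
  ~ abelian_group G ->
  residually_locally_torsion_free_nilpotent G ->
  alpha <> 1%g ->
  exists o : LO G, vlo_act (vlo_of o) alpha <> vlo_of o.
Proof.
elim/comm_ind: alpha => phi nabG rG phi1; apply: contrapT => nfix.
have fixO (o : LO G) : vlo_act (vlo_of o) (comm_pi phi) = vlo_of o.
  by apply: contrapT => no; apply: nfix; exists o.
apply: phi1; apply/comm_piP/comm_eqP; exists (comm_dom phi); split=> // x xD.
by rewrite comm_id_ext (comm_ext_fixed rG nabG fixO xD).
Qed.
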